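(* Let $d\ge2$, let $\bar A,A_1,\dots,A_d:V\to V'$ be the operators associated with a uniformly elliptic affine parametric diffusion coefficient $a(x,y)=\bar a(x)-\sum_{i=1}^dy_i\psi_i(x)$ with $r\le a\le R$ on $D\times U$, $U=[-1,1]^d$, $V=H^1_0(D)$, and let $u(y)\in V$ solve $(\bar A-\sum_{i=1}^dy_iA_i)u(y)=f$ with $f\in V'$. Suppose that $\sum_{i=1}^dA_i=\theta\bar A$ for some $\theta\in\,]0,1[$, and set $\rho:=1-r/\|\bar a\|_{L^\infty}$. Then there is a constant $C$, depending on $g:=\bar A^{-1}f$ and $\rho$ but not on $n$, such that $$d_n\big(u(U)\big)_V\le C\,e^{-|\ln\rho|\,n^{1/(d-1)}},\qquad n\in\mathbb{N}.$$
   Context: $D\subset\mathbb{R}^m$ is a bounded domain; $V=H^1_0(D)$ carries the norm $\|v\|_V=\|\nabla v\|_{L^2(D)}$, and $V'$ is its dual. The functions $\bar a,\psi_1,\dots,\psi_d\in L^\infty(D)$ are such that for some $0<r\le R<\infty$ one has $r\le a(x,y)\le R$ for all $x\in D$, $y\in U=[-1,1]^d$. The operators are $\langle\bar Au,v\rangle=\int_D\bar a\,\nabla u\cdot\nabla v\,dx$ and $\langle A_iu,v\rangle=\int_D\psi_i\nabla u\cdot\nabla v\,dx$. The Kolmogorov $n$-width is $d_n(u(U))_V=\inf_{\dim W=n}\sup_{y\in U}\min_{w\in W}\|u(y)-w\|_V$, the infimum being over $n$-dimensional linear subspaces $W$ of $V$. *)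

(* Defs.v *)
From HB Require Import structures.
From mathcomp Require Import all_boot all_order all_algebra.
From mathcomp Require Import all_classical all_reals all_analysis.
Import Order.TTheory GRing.Theory Num.Theory.
Import numFieldNormedType.Exports.

Set Implicit Arguments.
Unset Strict Implicit.
Unset Printing Implicit Defensive.

Local Open Scope classical_set_scope.
Local Open Scope ring_scope.

(* R^m is ['rV[R]_m]. As for [n.-tuple], its sigma-algebra is the one generated
   by the coordinates, that is, the Borel sigma-algebra. *)
Definition rV_display : measure_display -> measure_display.
Proof. exact. Qed.

Section measurable_rV.
Context {R : realType} {m : nat}.

Definition rV_coor (i : 'I_m) (x : 'rV[R]_m) : measurableTypeR R := x 0 i.

Let rV_set0 : g_sigma_preimage rV_coor set0.
Proof. exact: sigma_algebra0. Qed.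

Let rV_setC A : g_sigma_preimage rV_coor A -> g_sigma_preimage rV_coor (~` A).
Proof. exact: sigma_algebraC. Qed.

Let rV_bigcup (F : _^nat) : (forall i, g_sigma_preimage rV_coor (F i)) ->
  g_sigma_preimage rV_coor (\bigcup_i (F i)).
Proof. exact: sigma_algebra_bigcup. Qed.

HB.instance Definition _ := @isMeasurable.Build
  (rV_display default_measure_display) 'rV[R]_m
  (g_sigma_preimage rV_coor) rV_set0 rV_setC rV_bigcup.

Lemma measurable_rV_coor (i : 'I_m) : measurable_fun setT (rV_coor i).
Proof.
move=> _ Y mY; rewrite setTI; apply: sub_sigma_algebra => /=.
rewrite -bigcup_seq/=; exists i => /=; first by rewrite mem_index_enum.
by exists Y => //; rewrite setTI.
Qed.

Lemma measurable_fun_rV d (T : measurableType d) (f : T -> 'rV[R]_m) :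
  (forall i, measurable_fun setT (rV_coor i \o f)) -> measurable_fun setT f.
Proof.
move=> mf; have : g_sigma_preimage (fun i => rV_coor i \o f) `<=` measurable.
  apply: smallest_sub; first exact: sigma_algebra_measurable.
  rewrite -bigcup_seq; apply: bigcup_sub => i _ A [B mB <-].
  exact: mf.
rewrite g_sigma_preimage_comp => sub _ A mA.
by apply: sub; exists A.
Qed.

End measurable_rV.

Lemma product_sigma_finite d1 d2 (T1 : measurableType d1)
    (T2 : measurableType d2) (R : realType)
    (m1 : {sigma_finite_measure set T1 -> \bar R})
    (m2 : {sigma_finite_measure set T2 -> \bar R}) :
  sigma_finite setT (m1 \x m2)%E.
Proof.
have /sigma_finiteP[F [TF ndF Foo]] := sigma_finiteT m1.
have /sigma_finiteP[G [TG ndG Goo]] := sigma_finiteT m2.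
exists (fun n => F n `*` G n).
  rewrite -setXTT TF TG predeqE => -[x y]; split.
    move=> [/= [n _ Fnx] [k _ Gky]]; exists (maxn n k) => //; split.
    - by move: x Fnx; exact/subsetPset/ndF/leq_maxl.
    - by move: y Gky; exact/subsetPset/ndG/leq_maxr.
  by move=> [n _ []/= ? ?]; split; exists n.
move=> k; have [? ?] := Foo k; have [? ?] := Goo k.
split; first exact: measurableX.
by rewrite product_measure1E// lte_mul_pinfty// ge0_fin_numE.
Qed.

Section lebesgue_rV.
Context {R : realType}.

Definition rV_cons m (p : measurableTypeR R * 'rV[R]_m) : 'rV[R]_m.+1 :=
  row_mx (p.1 : R)%:M p.2.

Definition rV_uncons m (x : 'rV[R]_m.+1) : measurableTypeR R * 'rV[R]_m :=
  (x 0 0, rsubmx (x : 'rV_(1 + m))).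

Lemma rV_consEl m p (j : 'I_1) : @rV_cons m p 0 (lshift m j) = p.1.
Proof.
by apply: (etrans (row_mxEl _ _ _ _)); rewrite mxE ord1 eqxx mulr1n.
Qed.

Lemma rV_consEr m p (j : 'I_m) : @rV_cons m p 0 (rshift 1 j) = p.2 0 j.
Proof. exact: row_mxEr. Qed.

Lemma rV_consK m : cancel (@rV_cons m) (@rV_uncons m).
Proof.
move=> [a x]; rewrite /rV_uncons; congr (_, _); last exact: row_mxKr.
by rewrite (_ : 0 = lshift m (0 : 'I_1)) ?rV_consEl//; exact/val_inj.
Qed.

Lemma measurable_rV_cons m : measurable_fun setT (@rV_cons m).
Proof.
apply: measurable_fun_rV => i; rewrite -(splitK (i : 'I_(1 + m))).
case: (fintype.split (i : 'I_(1 + m))) => j /=.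
- rewrite (_ : _ \o _ = fst)//; apply/funext => p /=.
  exact: rV_consEl.
- rewrite (_ : _ \o _ = rV_coor j \o snd).
    by apply: measurableT_comp => //; exact: measurable_rV_coor.
  by apply/funext => p; exact: rV_consEr.
Qed.

Lemma measurable_rV_uncons m : measurable_fun setT (@rV_uncons m).
Proof.
apply: measurable_fun_pair; first exact: (measurable_rV_coor (0 : 'I_m.+1)).
apply: measurable_fun_rV => i.
rewrite (_ : _ \o _ = rV_coor (rshift 1 i : 'I_m.+1)).
  exact: measurable_rV_coor.
by apply/funext => x; rewrite /rV_coor /= mxE.
Qed.

Definition lebesgue_step m (mu : {sigma_finite_measure set 'rV[R]_m -> \bar R})
    : set 'rV[R]_m.+1 -> \bar R :=
  pushforward (@lebesgue_measure R \x mu)%E (@rV_cons m).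

Section step.
Context m (mu : {sigma_finite_measure set 'rV[R]_m -> \bar R}).

Let step0 : lebesgue_step mu set0 = 0%E.
Proof. by rewrite /lebesgue_step /pushforward preimage_set0 measure0. Qed.

Let step_ge0 A : (0 <= lebesgue_step mu A)%E.
Proof. by rewrite /lebesgue_step /pushforward; exact: measure_ge0. Qed.

Let step_sigma_additive : semi_sigma_additive (lebesgue_step mu).
Proof.
move=> F mF tF mUF; rewrite /lebesgue_step /pushforward preimage_bigcup.
apply: measure_semi_sigma_additive.
- by move=> n; rewrite -[X in measurable X]setTI; exact: measurable_rV_cons.
- apply/trivIsetP => /= i j _ _ ij; rewrite -preimage_setI.
  by move/trivIsetP : tF => /(_ _ _ _ _ ij) ->//; rewrite preimage_set0.
- rewrite -preimage_bigcup -[X in measurable X]setTI.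
  exact: measurable_rV_cons.
Qed.

HB.instance Definition _ := isMeasure.Build _ _ _ (lebesgue_step mu)
  step0 step_ge0 step_sigma_additive.

Let step_sigma_finite : sigma_finite setT (lebesgue_step mu).
Proof.
have /sigma_finiteP[F [TF ndF Foo]] :=
  product_sigma_finite [the sigma_finite_measure _ _ of @lebesgue_measure R] mu.
exists (fun n => (@rV_uncons m) @^-1` (F n)).
  by rewrite -preimage_bigcup -TF preimage_setT.
move=> n; have [mFn Fnoo] := Foo n; split.
  by rewrite -[X in measurable X]setTI; exact: measurable_rV_uncons.
rewrite /lebesgue_step /pushforward (_ : _ @^-1` _ = F n)//.
by apply/seteqP; split => p /=; rewrite rV_consK.
Qed.

HB.instance Definition _ := Measure_isSigmaFinite.Build _ _ _
  (lebesgue_step mu) step_sigma_finite.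

End step.

(* Lebesgue measure on R^m: the m-fold product of [lebesgue_measure], transported
   along R * R^m = R^(m+1). *)
Fixpoint lebesgue_rV m : {sigma_finite_measure set 'rV[R]_m -> \bar R} :=
  match m with
  | 0 => \d_ (0 : 'rV[R]_0)
  | k.+1 => lebesgue_step (lebesgue_rV k)
  end.

End lebesgue_rV.

Section sobolev.
Context {R : realType} {m : nat}.
Local Notation "'E'" := 'rV[R]_m.
Local Notation mu := (@lebesgue_rV R m).
Implicit Types (D : set E) (a : E -> R).

(* Values outside D are irrelevant: [v \_ D] is the extension of v by zero. *)
Definition Lp_on D (p : \bar R) (v : E -> R) : Prop := v \_ D \in Lfun mu p.

Definition Linf_norm D (v : E -> R) : R :=
  fine ('N[mu]_+oo[EFin \o (v \_ D)])%E.

Definition partial (i : 'I_m) (v : E -> R) : E -> R :=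
  fun x => 'D_(delta_mx 0 i : E) v x.

(* All iterated partial derivatives are Frechet differentiable. *)
Definition smooth (v : E -> R) : Prop :=
  forall (s : seq 'I_m) (x : E), differentiable (foldr partial v s) x.

Definition test_function D (phi : E -> R) : Prop :=
  let supp := closure [set x | phi x != 0] in
  [/\ smooth phi, compact supp & supp `<=` D].

(* A Sobolev function is represented by the pair of the function and its weak
   gradient, two such pairs being the same element of the Sobolev space when
   they agree a.e. on D. *)
Definition sobolev : Type := ((E -> R) * (E -> E))%type.

Definition weak_gradient D (v : E -> R) (G : E -> E) : Prop :=
  forall (phi : E -> R) (i : 'I_m), test_function D phi ->
    \int[mu]_(x in D) (v x * partial i phi x) =
    - \int[mu]_(x in D) (G x 0 i * phi x).

Definition H1 D (v : sobolev) : Prop :=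
  [/\ Lp_on D 2%:E v.1, forall i, Lp_on D 2%:E (fun x => v.2 x 0 i) &
      weak_gradient D v.1 v.2].

Definition dot (x y : E) : R := \sum_i x 0 i * y 0 i.

Definition H1_norm D (v : sobolev) : R :=
  Num.sqrt (\int[mu]_(x in D) (v.1 x ^+ 2 + dot (v.2 x) (v.2 x))).

Definition of_test (phi : E -> R) : sobolev :=
  (phi, fun x => \row_i partial i phi x).

(* H^1_0(D): the closure of the test functions in H^1(D). *)
Definition H10 D (v : sobolev) : Prop :=
  H1 D v /\ forall e : R, 0 < e ->
    exists2 phi, test_function D phi & H1_norm D (v - of_test phi) < e.

Definition V_norm D (v : sobolev) : R :=
  Num.sqrt (\int[mu]_(x in D) dot (v.2 x) (v.2 x)).

Definition V_dual D (f : sobolev -> R) : Prop :=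
  (forall (c : R) u v, H10 D u -> H10 D v ->
     f (c *: u + v) = c * f u + f v) /\
  exists M : R, forall v, H10 D v -> `|f v| <= M * V_norm D v.

(* The operator V -> V' given by u |-> (v |-> int_D a grad u . grad v). *)
Definition diffusion D (a : E -> R) (u v : sobolev) : R :=
  \int[mu]_(x in D) (a x * dot (u.2 x) (v.2 x)).

(* A linear subspace of V of dimension n, given by representatives of its
   elements. *)
Definition subspace_of_dim D (n : nat) (W : set sobolev) : Prop :=
  exists w : 'I_n -> sobolev,
  [/\ forall i, H10 D (w i),
      forall c : 'I_n -> R,
        (\sum_i c i *: w i).1 = 0 %[ae mu in D] -> forall i, c i = 0 &
      W = range (fun c : 'I_n -> R => \sum_i c i *: w i)].

(* The minimum over W is attained, W being finite-dimensional, hence is the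
   infimum. *)
Definition kolmogorov_width D (n : nat) (K : set sobolev) : \bar R :=
  ereal_inf [set
    ereal_sup [set ereal_inf [set (V_norm D (u - w))%:E | w in W] | u in K]
  | W in subspace_of_dim D n].

End sobolev.

(* Main.v *)
Require Import Defs.
From HB Require Import structures.
From mathcomp Require Import all_boot all_order all_algebra.
From mathcomp Require Import all_classical all_reals all_analysis.
From mathcomp Require Import measurable_realfun ess_sup_inf.
From mathcomp Require Import zify ring lra.
Import Order.TTheory GRing.Theory Num.Theory.
Import numFieldNormedType.Exports.

Set Implicit Arguments.
Unset Strict Implicit.
Unset Printing Implicit Defensive.

Local Open Scope classical_set_scope.
Local Open Scope ring_scope.

(** In the energy norm the operator B(y) = Abar^-1 (sum_i y_i A_i) has norm at most
    rho, so u(y) = sum_(k < K) B(y)^k g + B(y)^K u(y) with a remainder of size rho^K.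
    As sum_i A_i = theta Abar, B(y) is a scalar plus sum_(i >= 1) (y_i - y_0) B_i, and
    the partial sums lie in the span of the coefficients of the monomials of degree
    less than K in d - 1 variables. There are 'C(K + d - 2, d - 1) of these, and
    'C(K + d - 1, d - 1) <= (K + 1)^(d - 1); the shift from K to K + 1 is the factor
    rho^-1 in the constant.

    The width being an infimum, errors eps are harmless, which removes the need for
    the completeness of H^1_0: for a finite eps-net of parameters y^j, the solutions
    u(y^j) also solve the Galerkin problem in the span of g and the u(y^j), where
    the B_i are symmetric matrices in an energy-orthonormal basis. A subspace of
    dimension exactly n is obtained by adding small multiples of n bump functions
    with disjoint supports to the spanning family. *)

(** * Symmetric forms on a real vector space *)

Section forms.
Context {R : realType} {V : lmodType R}.
Implicit Types (H : V -> Prop) (a b : V -> V -> R).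

(** The contraction factor comes from ellipticity at y and at -y: almost everywhere |sum_i y_i
    psi_i| <= abar - r <= rho abar. This compares quadratic forms; the forms being symmetric,
    polarization makes it an operator bound in the energy norm, with no loss of a norm-equivalence
    constant. The matrices B_i do not commute with one another, but the parameters do: all words
    that carry the same monomial are gathered in one coefficient vector, which is why commutative
    monomials are counted. Elements of H^1_0 are represented by pairs of functions, so the energy
    form is only semidefinite, and an equality in V reads as a difference of energy norm zero. The
    net being finite, finitely many coefficients occur, so that one small perturbation of the
    spanning family serves all parameters. The constant must be fixed before the coefficient and d:
    testing the equation with its solution costs 1/(1 - rho), and the passage between energy norm
    and V-norm costs sqrt(L/r) = 1/sqrt(1 - rho), with L the sup norm of abar. *)

Definition lin_closed H := H 0 /\ forall c u v, H u -> H v -> H (c *: u + v).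

(** Required on [H] only: outside [H] the integrals behind the forms need not converge, and
    linearity may fail. *)
Definition sym_form H a :=
  (forall u v, H u -> H v -> a u v = a v u) /\
  (forall c u v w, H u -> H v -> H w -> a (c *: u + v) w = c * a u w + a v w).

Lemma lin_closed_sum H (I : Type) (s : seq I) (P : pred I) (c : I -> R)
    (v : I -> V) :
  lin_closed H -> (forall i, H (v i)) -> H (\sum_(i <- s | P i) c i *: v i).
Proof.
move=> [H0 HD] Hv; elim/big_ind: _ => //.
  by move=> x y Hx Hy; rewrite -(scale1r x); exact: HD.
by move=> i _; rewrite -[_ *: _]addr0; exact: HD.
Qed.

Lemma lin_closedD H u v : lin_closed H -> H u -> H v -> H (u + v).
Proof. by move=> [_ HD] Hu Hv; rewrite -(scale1r u); exact: HD. Qed.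

Lemma lin_closedZ H c u : lin_closed H -> H u -> H (c *: u).
Proof. by move=> [H0 HD] Hu; rewrite -[_ *: _]addr0; exact: HD. Qed.

Lemma lin_closedB H u v : lin_closed H -> H u -> H v -> H (u - v).
Proof. by move=> [_ HD] Hu Hv; rewrite addrC -scaleN1r; exact: HD. Qed.

Lemma form0l H a w : lin_closed H -> sym_form H a -> H w -> a 0 w = 0.
Proof.
move=> [H0 _] [_ aD] Hw; have := aD (-1) 0 0 w H0 H0 Hw.
by rewrite scaler0 addr0 mulN1r addNr.
Qed.

Lemma formDl H a u v w : lin_closed H -> sym_form H a -> H u -> H v -> H w ->
  a (u + v) w = a u w + a v w.
Proof. by move=> _ [_ aD] Hu Hv Hw; rewrite -{1}(scale1r u) aD// mul1r. Qed.

Lemma formZl H a c u w : lin_closed H -> sym_form H a -> H u -> H w ->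
  a (c *: u) w = c * a u w.
Proof.
move=> lH sa Hu Hw; rewrite -[c *: u]addr0 sa.2 ?(form0l lH sa)// ?addr0//.
exact: lH.1.
Qed.

Lemma formBl H a u v w : lin_closed H -> sym_form H a -> H u -> H v -> H w ->
  a (u - v) w = a u w - a v w.
Proof. by move=> _ [_ aD] Hu Hv Hw; rewrite addrC -scaleN1r aD// mulN1r addrC. Qed.

Lemma formZr H a c u w : lin_closed H -> sym_form H a -> H u -> H w ->
  a u (c *: w) = c * a u w.
Proof.
move=> lH sa Hu Hw; rewrite sa.1 ?(formZl _ lH)// ?(sa.1 w)//.
exact: lin_closedZ.
Qed.

Lemma formDr H a u v w : lin_closed H -> sym_form H a -> H u -> H v -> H w ->
  a w (u + v) = a w u + a w v.
Proof.
move=> lH sa Hu Hv Hw; rewrite sa.1 ?(formDl lH sa)// ?(sa.1 w)//.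
exact: lin_closedD.
Qed.

Lemma form_suml H a (I : Type) (s : seq I) (P : pred I) (c : I -> R)
    (v : I -> V) w :
  lin_closed H -> sym_form H a -> (forall i, H (v i)) -> H w ->
  a (\sum_(i <- s | P i) c i *: v i) w = \sum_(i <- s | P i) c i * a (v i) w.
Proof.
move=> lH sa Hv Hw; elim: s => [|i s IH].
  by rewrite !big_nil (form0l lH sa).
rewrite !big_cons; case: ifP => // Pi.
by rewrite sa.2 ?IH//; exact: lin_closed_sum.
Qed.

Lemma form_sumr H a (I : Type) (s : seq I) (P : pred I) (c : I -> R)
    (v : I -> V) w :
  lin_closed H -> sym_form H a -> (forall i, H (v i)) -> H w ->
  a w (\sum_(i <- s | P i) c i *: v i) = \sum_(i <- s | P i) c i * a w (v i).
Proof.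
move=> lH sa Hv Hw; rewrite sa.1 ?(form_suml _ _ _ lH)//.
  by apply: eq_bigr => i _; rewrite sa.1.
exact: lin_closed_sum.
Qed.

(** A - 2tB + t^2 C is nonnegative for all t, which bounds its discriminant; the minimum is at t =
    B/C. *)
Lemma sqr_le_of_quadratic (A B C : R) : 0 <= A -> 0 <= C ->
  (forall t, 2 * t * B <= A + t ^+ 2 * C) -> B ^+ 2 <= A * C.
Proof.
move=> A0 C0 tABC; have [C1|C1] := eqVneq C 0.
  have [->|B0] := eqVneq B 0; first by rewrite expr0n mulr_ge0.
  (* With C = 0 and B nonzero, this t would give A + 1 <= A. *)
  have := tABC ((A + 1) / (2 * B)); rewrite C1 mulr0 addr0.
  rewrite [X in X <= _](_ : _ = A + 1); first by lra.
  by field.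
have Cp : 0 < C by rewrite lt_def C1.
have := tABC (B / C).
rewrite (_ : 2 * (B / C) * B = 2 * (B ^+ 2 / C)); last by field.
rewrite (_ : (B / C) ^+ 2 * C = B ^+ 2 / C); last by field.
move=> h; have {h} : B ^+ 2 / C <= A by lra.
by rewrite ler_pdivrMr.
Qed.

(* Polarization turns a bound on the quadratic form into one on the bilinear form. *)
Lemma form_bound H a b (rho : R) u v : lin_closed H -> sym_form H a ->
  sym_form H b -> 0 <= rho -> (forall v, H v -> 0 <= a v v) ->
  (forall v, H v -> `|b v v| <= rho * a v v) -> H u -> H v ->
  (b u v) ^+ 2 <= rho ^+ 2 * a u u * a v v.
Proof.
move=> lH sa sb rho0 a0 ba Hu Hv.
rewrite (_ : _ * a v v = (rho * a u u) * (rho * a v v)); last by ring.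
apply: sqr_le_of_quadratic; rewrite ?mulr_ge0 ?a0// => t.
have Htv : H (t *: v) by exact: lin_closedZ.
have Hp : H (u + t *: v) by exact: lin_closedD.
have Hm : H (u - t *: v) by exact: lin_closedB.
have := ba _ Hp; have := ba _ Hm; rewrite !ler_norml.
have E c : sym_form H c -> forall s, c (u + s *: v) (u + s *: v) =
    c u u + 2 * s * c u v + s ^+ 2 * c v v.
  move=> sc s; have Hsv : H (s *: v) by exact: lin_closedZ.
  have Hs : H (u + s *: v) by exact: lin_closedD.
  rewrite (formDl lH sc)// (formDr lH sc)// (formDr lH sc)// (formZl _ lH sc)//.
  rewrite !(formZr _ lH sc)// (formZl _ lH sc)// (sc.1 v u)//; ring.
rewrite (_ : u - t *: v = u + (- t) *: v); last by rewrite scaleNr.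
rewrite !E// => /andP[h1 _] /andP[_ h4]; lra.
Qed.

Definition form_norm a v := Num.sqrt (a v v).

Lemma form_CS H a u v : lin_closed H -> sym_form H a ->
  (forall v, H v -> 0 <= a v v) -> H u -> H v ->
  `|a u v| <= form_norm a u * form_norm a v.
Proof.
move=> lH sa a0 Hu Hv; rewrite -sqrtrM ?a0// -sqrtr_sqr ler_sqrt ?mulr_ge0 ?a0//.
have := @form_bound H a a 1 u v lH sa sa ler01 a0.
rewrite expr1n mul1r; apply=> // w Hw.
by rewrite mul1r ger0_norm ?a0.
Qed.

Lemma form_norm_sqr H a u : (forall v, H v -> 0 <= a v v) -> H u ->
  form_norm a u ^+ 2 = a u u.
Proof. by move=> a0 Hu; rewrite sqr_sqrtr ?a0. Qed.

Lemma form_normD H a u v : lin_closed H -> sym_form H a ->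
  (forall v, H v -> 0 <= a v v) -> H u -> H v ->
  form_norm a (u + v) <= form_norm a u + form_norm a v.
Proof.
move=> lH sa a0 Hu Hv; have Huv := lin_closedD lH Hu Hv.
rewrite -(@ler_pXn2r _ 2)// ?nnegrE ?addr_ge0 ?sqrtr_ge0//.
rewrite sqrrD !(form_norm_sqr a0)//.
rewrite (formDl lH sa)// !(formDr lH sa)// (sa.1 v u)//.
have := form_CS lH sa a0 Hu Hv; rewrite ler_norml => /andP[_ h]; lra.
Qed.

Lemma form_normZ H a c u : lin_closed H -> sym_form H a ->
  (forall v, H v -> 0 <= a v v) -> H u ->
  form_norm a (c *: u) = `|c| * form_norm a u.
Proof.
move=> lH sa a0 Hu; rewrite /form_norm (formZl _ lH sa)//; last exact: lin_closedZ.
by rewrite (formZr _ lH sa)// mulrA -expr2 sqrtrM ?sqr_ge0// sqrtr_sqr.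
Qed.

Lemma form_norm0 H a : lin_closed H -> sym_form H a -> form_norm a 0 = 0.
Proof. by move=> lH sa; rewrite /form_norm (form0l lH sa) ?sqrtr0//; exact: lH.1. Qed.

Lemma form_norm_sum H a (I : Type) (s : seq I) (c : I -> R)
    (v : I -> V) : lin_closed H -> sym_form H a ->
  (forall v, H v -> 0 <= a v v) -> (forall i, H (v i)) ->
  form_norm a (\sum_(i <- s) c i *: v i) <=
  \sum_(i <- s) `|c i| * form_norm a (v i).
Proof.
move=> lH sa a0 Hv; elim: s => [|i s IH].
  by rewrite !big_nil (form_norm0 lH sa).
rewrite !big_cons; apply: le_trans (form_normD lH sa a0 _ _) _.
- exact: lin_closedZ.
- exact: lin_closed_sum.
- by rewrite (form_normZ _ lH sa a0)// lerD2l.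
Qed.

(** Vectors of zero energy pair to zero in every form dominated by [a]. This stands in for passing
    to the quotient by null vectors. *)
Lemma form_null H a b (rho : R) v w : lin_closed H -> sym_form H a ->
  sym_form H b -> 0 <= rho -> (forall v, H v -> 0 <= a v v) ->
  (forall v, H v -> `|b v v| <= rho * a v v) -> H v -> H w ->
  a v v = 0 -> b v w = 0.
Proof.
move=> lH sa sb rho0 a0 ba Hv Hw av0.
have := form_bound lH sa sb rho0 a0 ba Hv Hw.
rewrite av0 mulr0 mul0r => h; apply/eqP; rewrite -sqrf_eq0 eq_le h.
exact: sqr_ge0.
Qed.

(** As [a] is only semidefinite and [s] may be dependent, the residual of a new vector is normalized
    and adjoined only when its norm is nonzero; expansions hold up to null vectors. *)
Lemma Gram_Schmidt H a (s : seq V) : lin_closed H -> sym_form H a ->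
  (forall v, H v -> 0 <= a v v) -> (forall v, v \in s -> H v) ->
  exists q (e : 'I_q -> V),
    [/\ forall i, H (e i), forall i j, a (e i) (e j) = (i == j)%:R &
        forall v, v \in s ->
          form_norm a (v - \sum_i a v (e i) *: e i) = 0].
Proof.
move=> lH sa a0; elim: s => [_|v s IH Hs].
  by exists 0%N, (fun=> 0); split=> // -[].
have Hv : H v by apply: Hs; rewrite inE eqxx.
have /IH[q [e [He ee es]]] : forall v, v \in s -> H v.
  by move=> x xs; apply: Hs; rewrite inE xs orbT.
set w := v - \sum_i a v (e i) *: e i.
have Hw : H w by apply: lin_closedB => //; exact: lin_closed_sum.
have we i : a w (e i) = 0.
  rewrite (formBl lH sa)//; last exact: lin_closed_sum.
  rewrite (form_suml _ _ _ lH sa)// (bigD1 i)//= ee eqxx mulr1 big1 ?addr0 ?subrr//.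
  by move=> j ji; rewrite ee (negbTE ji) mulr0.
have [w0|w0] := eqVneq (form_norm a w) 0.
  exists q, e; split => // x; rewrite inE => /orP[/eqP ->//|]; exact: es.
pose e' (i : 'I_q.+1) := oapp e ((form_norm a w)^-1 *: w) (unlift ord0 i).
have He' i : H (e' i).
  by rewrite /e'; case: unliftP => [j|] _ //=; exact: lin_closedZ.
have e'0 : e' ord0 = (form_norm a w)^-1 *: w by rewrite /e' unlift_none.
have e'S j : e' (lift ord0 j) = e j by rewrite /e' liftK.
exists q.+1, e'; split => //.
  move=> i j; rewrite /e'; case: unliftP => [i'|] ->; case: unliftP => [j'|] -> /=.
  - by rewrite ee (inj_eq (@lift_inj _ _)).
  - by rewrite (formZr _ lH sa)// sa.1// we mulr0.
  - by rewrite (formZl _ lH sa)// we mulr0.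
  - rewrite (formZl _ lH sa)//; last exact: lin_closedZ.
    rewrite (formZr _ lH sa)// -(form_norm_sqr a0)//.
    by field.
move=> x; rewrite inE big_ord_recl e'0; under eq_bigr do rewrite e'S.
move=> /predU1P[->|xs].
  rewrite (_ : a v _ = form_norm a w).
    by rewrite scalerA divff// scale1r subrK subrr (form_norm0 lH sa).
  rewrite (formZr _ lH sa)//.
  have -> : a v w = a w w.
    rewrite -[in LHS](subrK (\sum_i a v (e i) *: e i) v) -/w (formDl lH sa)//.
      rewrite (form_suml _ _ _ lH sa)// big1 ?addr0// => i _.
      by rewrite (sa.1 (e i))// we mulr0.
    exact: lin_closed_sum.
  by rewrite -(form_norm_sqr a0)// expr2 mulrA mulVf// mul1r.
have Hx : H x by apply: Hs; rewrite inE xs orbT.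
(* [x] is its expansion in the old [e] plus a null vector, both orthogonal to [w], so the new basis
   vector does not alter the expansion. *)
have xw : a x w = 0.
  have Hsx : H (\sum_i a x (e i) *: e i) by exact: lin_closed_sum.
  rewrite -(subrK (\sum_i a x (e i) *: e i) x) (formDl lH sa)//; last first.
    exact: lin_closedB.
  have -> : a (\sum_i a x (e i) *: e i) w = 0.
    rewrite (form_suml _ _ _ lH sa)// big1// => i _.
    by rewrite (sa.1 (e i))// we mulr0.
  rewrite addr0.
  apply: (@form_null H a a 1) => //.
  - by move=> u Hu; rewrite mul1r ger0_norm ?a0.
  - exact: lin_closedB.
  - by rewrite -(form_norm_sqr a0) ?es ?expr0n//; exact: lin_closedB.
by rewrite (formZr _ lH sa)// xw mulr0 scale0r add0r es.
Qed.

End forms.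

(** * Neumann sums and monomials *)

Section monomials.
Context {R : realType}.

(** Exponents are capped at k so that the multi-indices form a finite type; those of total degree at
    most k, the ones needed, all satisfy the cap. *)
Definition monomial p k (z : 'I_p -> R) (nu : p.-tuple 'I_k.+1) : R :=
  \prod_i z i ^+ tnth nu i.

Definition tdeg p k (nu : p.-tuple 'I_k.+1) : nat := (\sum_i tnth nu i)%N.

(** The coefficients [T] do not depend on z: this is a vector-valued polynomial in commuting scalar
    variables, even when [P] is built from noncommuting matrices. *)
Definition homogeneous p k q (j : nat) (P : ('I_p -> R) -> 'rV[R]_q) : Prop :=
  exists T : p.-tuple 'I_k.+1 -> 'rV[R]_q,
  forall z, P z = \sum_(nu | tdeg nu == j) monomial z nu *: T nu.

Lemma homogeneous_sum p k q j (I : Type) (s : seq I) (Q : pred I)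
    (P : I -> ('I_p -> R) -> 'rV[R]_q) :
  (forall i, Q i -> homogeneous k j (P i)) ->
  homogeneous k j (fun z => \sum_(i <- s | Q i) P i z).
Proof.
move=> hP; elim: s => [|i s [T hT]].
  by exists (fun=> 0) => z; rewrite big_nil big1// => nu _; rewrite scaler0.
case Qi : (Q i); last by exists T => z; rewrite big_cons Qi hT.
have [T' hT'] := hP i Qi; exists (fun nu => T' nu + T nu) => z.
rewrite big_cons Qi hT hT' -big_split; apply: eq_bigr => nu _.
by rewrite /= scalerDr.
Qed.

Lemma homogeneous_monomial p k q (nu : p.-tuple 'I_k.+1) (v : 'rV[R]_q) :
  homogeneous k (tdeg nu) (fun z => monomial z nu *: v).
Proof.
exists (fun mu => if mu == nu then v else 0) => z.
rewrite (bigD1 nu)//= eqxx big1 ?addr0// => mu /andP[_ /negbTE ->].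
by rewrite scaler0.
Qed.

Definition tincr p k (i : 'I_p) (nu : p.-tuple 'I_k.+1) : p.-tuple 'I_k.+1 :=
  [tuple inord (tnth nu l + (l == i)) | l < p].

Lemma tincrE p k (i l : 'I_p) (nu : p.-tuple 'I_k.+1) : (tdeg nu < k)%N ->
  tnth (tincr i nu) l = (tnth nu l + (l == i))%N :> nat.
Proof.
move=> nuk; rewrite tnth_mktuple inordK// ltnS.
have [->|_] := eqVneq l i; last by rewrite addn0 -ltnS.
rewrite addn1; apply: leq_ltn_trans nuk.
by rewrite /tdeg (bigD1 i)//= leq_addr.
Qed.

Lemma homogeneous_mul p k q j (P : ('I_p -> R) -> 'rV[R]_q) (i : 'I_p) (Z : 'M[R]_q) :
  (j < k)%N -> homogeneous k j P ->
  homogeneous k j.+1 (fun z => z i *: (P z *m Z)).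
Proof.
move=> jk [T hT].
have -> : (fun z => z i *: (P z *m Z)) =
    (fun z => \sum_(nu | tdeg nu == j) (z i * monomial z nu) *: (T nu *m Z)).
  apply/funext => z; rewrite hT mulmx_suml scaler_sumr.
  by apply: eq_bigr => nu _; rewrite -scalemxAl scalerA.
apply: homogeneous_sum => nu /eqP nuj; rewrite -nuj in jk *.
have -> : (tdeg nu).+1 = tdeg (tincr i nu).
  rewrite /tdeg (eq_bigr _ (fun l _ => tincrE i l jk)) big_split/=.
  rewrite [X in (_ + X)%N](bigD1 i)//= eqxx [X in (1 + X)%N]big1 ?addn1//.
  by move=> l /negbTE ->.
rewrite (_ : (fun z => _) = fun z => monomial z (tincr i nu) *: (T nu *m Z)).
  exact: homogeneous_monomial.
apply/funext => z; congr (_ *: _); rewrite /monomial.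
rewrite [RHS](eq_bigr (fun l => z l ^+ tnth nu l * z l ^+ (l == i))); last first.
  by move=> l _; rewrite tincrE// exprD.
rewrite big_split/= mulrC; congr (_ * _).
rewrite (bigD1 i)//= eqxx expr1 big1 ?mulr1// => l /negbTE ->.
by rewrite expr0.
Qed.

Lemma homogeneous_power p k q (Z : 'I_p -> 'M[R]_q) (g : 'rV[R]_q) j :
  (j <= k)%N -> homogeneous k j (fun z => g *m (\sum_i z i *: Z i) ^+ j).
Proof.
elim: j => [_|j IH jk].
  have -> : (fun z : 'I_p -> R => g *m (\sum_i z i *: Z i) ^+ 0) =
      (fun z => monomial z [tuple (@ord0 k) | l < p] *: g).
    apply/funext => z; rewrite expr0 mulmx1 /monomial big1 ?scale1r//.
    by move=> l _; rewrite tnth_mktuple expr0.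
  have t0 : tdeg [tuple (@ord0 k) | l < p] = 0%N.
    by rewrite /tdeg big1// => l _; rewrite tnth_mktuple.
  by have := homogeneous_monomial [tuple (@ord0 k) | l < p] g; rewrite t0.
have -> : (fun z : 'I_p -> R => g *m (\sum_i z i *: Z i) ^+ j.+1) =
   (fun z => \sum_i z i *: (g *m (\sum_i z i *: Z i) ^+ j *m Z i)).
  apply/funext => z; rewrite exprSr -mulmxE mulmxA mulmx_sumr.
  by apply: eq_bigr => i _; rewrite scalemxAr.
by apply: homogeneous_sum => i _; apply: homogeneous_mul => //; exact/IH/ltnW.
Qed.

(* Of degree less than K, in p variables. *)
Definition num_monomials p K := if K is k.+1 then 'C(p + k, p) else 0%N.

(* Since sum_i B_i is scalar, only the p differences y_(i+1) - y_0 enter B(y) through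
   noncommuting matrices. *)
Lemma neumann_span p q K (B : 'I_p.+1 -> 'M[R]_q) (theta : R) (g : 'rV[R]_q) :
  \sum_i B i = theta%:M ->
  exists T : 'I_(num_monomials p K) -> 'rV[R]_q, forall y : 'I_p.+1 -> R,
  exists c, \sum_(j < K) g *m (\sum_i y i *: B i) ^+ j = \sum_i c i *: T i.
Proof.
move=> sB; case: K => [|k].
  by exists (fun=> 0) => y; exists (fun=> 0); rewrite !big_ord0.
pose Z i := B (lift ord0 i).
have /choice[T hT] (j : 'I_k.+1) : exists T : p.-tuple 'I_k.+1 -> 'rV[R]_q,
    forall z, g *m (\sum_i z i *: Z i) ^+ j =
              \sum_(nu | tdeg nu == j) monomial z nu *: T nu.
  by have [T hT] := @homogeneous_power p k q Z g j (ltn_ord j); exists T.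
pose S := [set t : p.-tuple 'I_k.+1 | (\sum_(i <- t) i <= k)%N]%SET.
(* Each multi-index takes its coefficient from the power of its own degree, so one family serves
   every power up to k. *)
pose W nu := T (inord (tdeg nu)) nu.
have Sdeg nu : (nu \in S) = (tdeg nu <= k)%N by rewrite inE big_tuple.
have SE : #|S| = num_monomials p k.+1 by rewrite card_partial_ord_partitions.
rewrite -SE; exists (fun i => W (enum_val i)) => y.
suff [c ->] : exists c, \sum_(j < k.+1) g *m (\sum_i y i *: B i) ^+ j =
    \sum_(nu in S) c nu *: W nu.
  by exists (fun i => c (enum_val i)); rewrite big_enum_val.
pose inW (x : 'rV[R]_q) := exists c, x = \sum_(nu in S) c nu *: W nu.
have inW0 : inW 0.
  by exists (fun=> 0); rewrite big1// => nu _; rewrite scale0r.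
have inWD x x' : inW x -> inW x' -> inW (x + x').
  move=> [c ->] [c' ->]; exists (fun nu => c nu + c' nu).
  by rewrite -big_split; apply: eq_bigr => nu _; rewrite scalerDl.
have inWZ s x : inW x -> inW (s *: x).
  move=> [c ->]; exists (fun nu => s * c nu).
  by rewrite scaler_sumr; apply: eq_bigr => nu _; rewrite scalerA.
pose z i := y (lift ord0 i) - y ord0.
have inWP j : (j <= k)%N -> inW (g *m (\sum_i z i *: Z i) ^+ j).
  move=> jk; exists (fun nu => if tdeg nu == j then monomial z nu else 0).
  rewrite (hT (Ordinal (jk : (j < k.+1)%N))) /=.
  rewrite big_mkcond [RHS]big_mkcond; apply: eq_bigr => nu _.
  rewrite Sdeg; case: eqP => [nuj|]; last by rewrite scale0r if_same.
  rewrite nuj jk /W nuj; congr (_ *: T _ _); apply/val_inj.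
  by rewrite /= inordK.
(* Here sum_i B_i = theta I eliminates B_0, which leaves p matrices and a scalar part. *)
have -> : \sum_i y i *: B i = \sum_i z i *: Z i + (y ord0 * theta)%:M.
  rewrite -scale_scalar_mx -sB scaler_sumr !big_ord_recl addrCA; congr (_ + _).
  by rewrite -big_split; apply: eq_bigr => i _; rewrite /= -scalerDl subrK.
apply: (big_ind inW) => // j _.
(* The scalar part commutes with everything, so the binomial formula applies and only powers up to j
   of the p-variable sum occur. *)
rewrite exprDn_comm; last by rewrite /GRing.comm -!mulmxE scalar_mxC.
rewrite mulmx_sumr; apply: (big_ind inW) => // i _.
have -> : (y ord0 * theta)%:M ^+ i = ((y ord0 * theta) ^+ i)%:M :> 'M[R]_q.
  elim: (nat_of_ord i) => [|l IH]; first by rewrite !expr0.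
  by rewrite !exprS IH -mulmxE -scalar_mxM.
rewrite -mulmxE mul_mx_scalar -scaler_nat -!scalemxAr.
by apply/inWZ/inWZ/inWP; rewrite (leq_trans (leq_subr _ _))// -ltnS.
Qed.

(** Induction on p: (p + 1) 'C(p + 1 + K, p + 1) = (p + 1 + K) 'C(p + K, p), and p + 1 + K <= (p +
    1)(K + 1). *)
Lemma num_monomials_le p K : (num_monomials p K.+1 <= K.+1 ^ p)%N.
Proof.
rewrite /num_monomials; elim: p => [|p IH]; first by rewrite bin0.
rewrite -(leq_pmul2l (ltn0Sn p)) addSn -mul_bin_diag/= expnSr.
rewrite mulnCA [X in (X <= _)%N]mulnC leq_mul// mulSn mulnS addSn; lia.
Qed.

End monomials.

(** * Galerkin approximation *)

Section galerkin.
Context {R : realType} {V : lmodType R} (H : V -> Prop) (a : V -> V -> R)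
  (p : nat) (b : 'I_p.+1 -> V -> V -> R) (rho theta : R) (g : V).
Context (lH : lin_closed H) (sa : sym_form H a) (sb : forall i, sym_form H (b i))
  (a0 : forall v, H v -> 0 <= a v v) (rho0 : 0 <= rho) (rho1 : rho < 1) (Hg : H g).

Local Notation cube := (fun y : 'I_p.+1 -> R => forall i, `|y i| <= 1).
Local Notation nrm := (form_norm a).

Context
  (ba : forall y, cube y -> forall v, H v -> `|\sum_i y i * b i v v| <= rho * a v v)
  (btheta : forall w v, H w -> H v -> \sum_i b i w v = theta * a w v).

(** Plays the part of a(B(y) v, w), without the inverse of Abar. *)
Let by_ (y : 'I_p.+1 -> R) v w := \sum_i y i * b i v w.

Let sby y : sym_form H (by_ y).
Proof.
split=> [u v Hu Hv|c u v w Hu Hv Hw].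
  by apply: eq_bigr => i _; rewrite (sb i).1.
rewrite /by_ mulr_sumr -big_split; apply: eq_bigr => i _.
by rewrite /= (sb i).2// mulrDr mulrCA.
Qed.

Let by_CS y v w : cube y -> H v -> H w -> `|by_ y v w| <= rho * (nrm v * nrm w).
Proof.
move=> hy Hv Hw; have := form_bound lH sa (sby y) rho0 a0 (ba hy) Hv Hw.
rewrite -!(form_norm_sqr a0)// -!exprMn -mulrA -[leLHS]real_normK ?num_real//.
by rewrite ler_pXn2r// nnegrE !mulr_ge0// sqrtr_ge0.
Qed.

(** The datum f enters as a(g, v), with g = Abar^-1 f. *)
Definition solves (y : 'I_p.+1 -> R) (u : V) :=
  H u /\ forall v, H v -> a u v - \sum_i y i * b i u v = a g v.

(** Testing with u itself gives |u|^2 <= rho |u|^2 + |g| |u|. *)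
Lemma solves_bound y u : cube y -> solves y u -> nrm u <= nrm g / (1 - rho).
Proof.
move=> hy [Hu uE]; have := uE u Hu; rewrite -/(by_ y u u) => E.
have n0 : 0 <= nrm u by exact: sqrtr_ge0.
rewrite ler_pdivlMr ?subr_gt0//.
have [u0|u0] := eqVneq (nrm u) 0; first by rewrite u0 mul0r sqrtr_ge0.
have np : 0 < nrm u by rewrite lt_def u0.
rewrite -(ler_pM2r np).
have := by_CS hy Hu Hu; rewrite ler_norml => /andP[_ h1].
have := form_CS lH sa a0 Hg Hu; rewrite ler_norml => /andP[_ h2].
have := form_norm_sqr a0 Hu; rewrite expr2 => h3.
by rewrite mulrAC mulrBr mulr1; lra.
Qed.

(** The difference e of the solutions satisfies a(e, e) - b_y(e, e) = b_(y - y')(u', e). One factor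
    1/(1 - rho) is the coercivity of the left side, the other the bound on u'. *)
Lemma solves_lipschitz y y' u u' (delta : R) : 0 < delta -> cube y -> cube y' ->
  solves y u -> solves y' u' -> (forall i, `|y i - y' i| <= delta) ->
  nrm (u - u') <= delta * (nrm g / (1 - rho) ^+ 2).
Proof.
move=> d0 hy hy' su su' yy'; have [Hu uE] := su; have [Hu' uE'] := su'.
have He : H (u - u') by exact: lin_closedB.
have n0 : 0 <= nrm (u - u') by exact: sqrtr_ge0.
have r1 : 0 < 1 - rho by rewrite subr_gt0.
have [e0|e0] := eqVneq (nrm (u - u')) 0.
  by rewrite e0 mulr_ge0 ?(ltW d0)// divr_ge0 ?sqrtr_ge0 ?sqr_ge0.
have np : 0 < nrm (u - u') by rewrite lt_def e0.
(* Rescaling y - y' puts it in the cube, where the contraction bound applies. *)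
pose z i := (y i - y' i) / delta.
have hz : cube z.
  by move=> i; rewrite normrM normfV (gtr0_norm d0) ler_pdivrMr// mul1r.
have E : a (u - u') (u - u') = by_ y (u - u') (u - u') + delta * by_ z u' (u - u').
  have := uE _ He; rewrite -(uE' _ He) -/(by_ _ _ _) -/(by_ _ _ _) => h.
  rewrite (formBl lH sa)// (formBl lH (sby y))//.
  have -> : delta * by_ z u' (u - u') = by_ y u' (u - u') - by_ y' u' (u - u').
    rewrite mulr_sumr -sumrB; apply: eq_bigr => i _.
    by rewrite mulrA mulrCA divff ?gt_eqF// mulr1 mulrBl.
  by lra.
have := by_CS hy He He; rewrite ler_norml => /andP[_ h1].
have := by_CS hz Hu' He; rewrite ler_norml => /andP[_ h2].
have h3 := form_norm_sqr a0 He.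
have h4 := solves_bound hy' su'.
have h5 : delta * by_ z u' (u - u') <= delta * (nrm g / (1 - rho) * nrm (u - u')).
  rewrite ler_pM2l//; apply: le_trans h2 _.
  apply: (@le_trans _ _ (1 * (nrm u' * nrm (u - u')))).
    by rewrite ler_wpM2r ?mulr_ge0 ?sqrtr_ge0// ltW.
  by rewrite mul1r ler_wpM2r.
have : nrm (u - u') * (1 - rho) <= delta * (nrm g / (1 - rho)).
  rewrite -(ler_pM2r np); move: h1 h3 h5; rewrite E.
  set n := nrm (u - u'); set G := nrm g / _ => h1 h3 h5; lra.
rewrite -ler_pdivlMr// => h; apply: le_trans h _.
by rewrite expr2 invfM !mulrA.
Qed.

(* The u j also solve the problem restricted to the span of g and the u j. *)
Lemma galerkin_span (J : finType) (y : J -> 'I_p.+1 -> R) (u : J -> V) K :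
  (forall j, cube (y j)) -> (forall j, solves (y j) (u j)) ->
  exists t : 'I_(num_monomials p K) -> V, (forall i, H (t i)) /\
  forall j, exists c, nrm (u j - \sum_i c i *: t i) <= rho ^+ K * (nrm g / (1 - rho)).
Proof.
move=> hy su.
have [|q [e [He ee es]]] := @Gram_Schmidt _ _ H a (g :: codom u) lH sa a0.
  by move=> v; rewrite inE => /predU1P[->//|/codomP[j ->]]; exact: (su j).1.
(* Coordinates in the energy-orthonormal family are row vectors; the matrices act on the right. *)
pose vec (x : 'rV[R]_q) := \sum_k x 0 k *: e k.
have Hvec x : H (vec x) by exact: lin_closed_sum.
have avece x k : a (vec x) (e k) = x 0 k.
  rewrite (form_suml _ _ _ lH sa)// (bigD1 k)//= ee eqxx mulr1 big1 ?addr0//.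
  by move=> i ik; rewrite ee (negbTE ik) mulr0.
have avec x x' : a (vec x) (vec x') = \sum_k x 0 k * x' 0 k.
  rewrite (form_sumr _ _ _ lH sa)//; apply: eq_bigr => k _.
  by rewrite avece mulrC.
pose B i : 'M[R]_q := \matrix_(l, k) b i (e l) (e k).
pose Bj j := \sum_i y j i *: B i.
have byvec j x k : by_ (y j) (vec x) (e k) = (x *m Bj j) 0 k.
  rewrite (form_suml _ _ _ lH (sby _))// mxE; apply: eq_bigr => l _.
  by rewrite summxE; congr (_ * _); apply: eq_bigr => i _; rewrite !mxE.
(* Testing with the image w = x B itself: |w|^2 = b_y(x, w) <= rho |x| |w|. *)
have contr j x : nrm (vec (x *m Bj j)) <= rho * nrm (vec x).
  set n := nrm (vec _); have n0 : 0 <= n by exact: sqrtr_ge0.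
  have [->|nn0] := eqVneq n 0; first by rewrite mulr_ge0 ?sqrtr_ge0.
  have np : 0 < n by rewrite lt_def nn0.
  rewrite -(ler_pM2r np) -expr2 (form_norm_sqr a0)// avec.
  have -> : \sum_k (x *m Bj j) 0 k * (x *m Bj j) 0 k =
      by_ (y j) (vec x) (vec (x *m Bj j)).
    rewrite (form_sumr _ _ _ lH (sby _))//; apply: eq_bigr => k _.
    by rewrite byvec.
  have := by_CS (hy j) (Hvec x) (Hvec (x *m Bj j)).
  by rewrite ler_norml mulrA => /andP[].
have contrK j x k : nrm (vec (x *m Bj j ^+ k)) <= rho ^+ k * nrm (vec x).
  elim: k => [|k IH]; first by rewrite !expr0 mulmx1 mul1r.
  rewrite exprSr exprS -mulmxE mulmxA -mulrA.
  by apply: le_trans (contr _ _) _; rewrite ler_wpM2l.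
pose co v : 'rV[R]_q := \row_k a v (e k).
have vecco v : vec (co v) = \sum_k a v (e k) *: e k.
  by apply: eq_bigr => k _; rewrite mxE.
have sB : \sum_i B i = theta%:M.
  apply/matrixP => l k; rewrite summxE mxE.
  under eq_bigr do rewrite mxE.
  by rewrite btheta// ee mulr_natr.
have [T hT] := @neumann_span R p q K B theta (co g) sB.
exists (fun i => vec (T i)); split=> // j.
have [c hc] := hT (y j); exists c.
have [Huj ujE] := su j.
have uj0 : nrm (u j - vec (co (u j))) = 0.
  by rewrite vecco; apply: es; rewrite inE codom_f orbT.
have g0 : nrm (g - vec (co g)) = 0 by rewrite vecco; apply: es; rewrite inE eqxx.
(* The equation tested with each e_k; replacing u_j by its projection changes it by a null vector
   only. *)
have fix_ : co (u j) = co g + co (u j) *m Bj j.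
  apply/rowP => k; have := ujE (e k) (He k); rewrite -/(by_ _ _ _) !mxE => E.
  have -> : \sum_l co (u j) 0 l * Bj j l k = by_ (y j) (u j) (e k).
    transitivity ((co (u j) *m Bj j) 0 k); first by rewrite mxE.
    rewrite -byvec; apply/eqP; rewrite eq_sym -subr_eq0 -(formBl lH (sby _))//.
    apply/eqP; apply: (form_null lH sa (sby (y j)) rho0 a0 (ba (hy j))) => //.
      exact: lin_closedB.
    by rewrite -(form_norm_sqr a0) ?uj0 ?expr0n//; exact: lin_closedB.
  by rewrite -E subrK.
(* The Neumann sum with its exact remainder, whose size [contrK] controls. *)
have iter k : co (u j) = \sum_(l < k) co g *m Bj j ^+ l + co (u j) *m Bj j ^+ k.
  elim: k => [|k IH]; first by rewrite big_ord0 add0r expr0 mulmx1.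
  by rewrite big_ord_recr/= -addrA {1}IH {1}fix_ mulmxDl exprS -mulmxE mulmxA.
have vec_lin : vec (co (u j)) - \sum_i c i *: vec (T i) = vec (co (u j) *m Bj j ^+ K).
  have -> : \sum_i c i *: vec (T i) = vec (\sum_i c i *: T i).
    rewrite /vec; under eq_bigr do rewrite scaler_sumr.
    rewrite exchange_big; apply: eq_bigr => k _; rewrite summxE scaler_suml.
    by apply: eq_bigr => i _; rewrite mxE scalerA.
  rewrite -hc {1}(iter K) -sumrB; apply: eq_bigr => k _.
  by rewrite -scalerBl [X in X - _]mxE addrAC subrr add0r.
rewrite -(subrK (vec (co (u j))) (u j)) -addrA vec_lin.
apply: le_trans (form_normD lH sa a0 _ _) _ => //; first exact: lin_closedB.
rewrite uj0 add0r; apply: le_trans (contrK _ _ _) _.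
rewrite ler_wpM2l ?exprn_ge0//.
(* The projection of u_j is no longer than u_j, their difference being null. *)
apply: le_trans _ (solves_bound (hy j) (su j)).
rewrite -(subrK (u j) (vec (co (u j)))).
apply: le_trans (form_normD lH sa a0 _ _) _ => //; first exact: lin_closedB.
rewrite -opprB -scaleN1r (form_normZ _ lH sa a0) ?uj0 ?mulr0 ?add0r//.
exact: lin_closedB.
Qed.

(** A grid in the cube, fine enough for the Lipschitz bound to cost at most eps, reduces all
    parameters to finitely many. The coefficients [c] then depend on the grid point only, so
    finitely many occur. *)
Lemma galerkin_net (u : ('I_p.+1 -> R) -> V) K (eps : R) : 0 < eps ->
  (forall y, cube y -> solves y (u y)) ->
  exists (J : finType) (t : 'I_(num_monomials p K) -> V)
    (c : J -> 'I_(num_monomials p K) -> R), (forall i, H (t i)) /\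
  forall y, cube y -> exists j,
    nrm (u y - \sum_i c j i *: t i) <= rho ^+ K * (nrm g / (1 - rho)) + eps.
Proof.
move=> eps0 su; set L := nrm g / (1 - rho) ^+ 2.
have L0 : 0 <= L by rewrite divr_ge0 ?sqrtr_ge0// sqr_ge0.
have [N] : exists N : nat, L / eps < N.+1%:R.
  exists (Num.bound (L / eps)); rewrite (lt_le_trans (archi_boundP _))//.
    by rewrite divr_ge0// ltW.
  by rewrite ler_nat.
set M := N.+1 => hN; have M0 : 0 < M%:R :> R by rewrite ltr0n.
(* Step 1/M on [-1, 1] in each coordinate; the indices 0 and 2M give the endpoints. *)
pose J := {ffun 'I_p.+1 -> 'I_(M + M).+1}.
pose yj (j : J) i : R := (j i)%:R / M%:R - 1.
have hyj j : cube (yj j).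
  move=> i; rewrite ler_norml /yj lerBrDr addNr lerBlDr.
  rewrite divr_ge0 ?ler0n// ler_pdivrMr// mulrDl mul1r -natrD ler_nat.
  by rewrite -ltnS ltn_ord.
have [t [Ht ht]] := @galerkin_span J yj (fun j => u (yj j)) K hyj
  (fun j => su _ (hyj j)).
have [c hc] := choice ht.
exists J, t, c; split=> // y hy.
(* Each coordinate of y is rounded down to the grid. *)
pose k i := Num.trunc ((y i + 1) * M%:R).
have yM i : 0 <= (y i + 1) * M%:R.
  by have := hy i; rewrite ler_norml => /andP[h _]; rewrite mulr_ge0// -lerBlDr sub0r.
have kM i : (k i < (M + M).+1)%N.
  rewrite ltnS -(ler_nat R) (le_trans (_ : _ <= (y i + 1) * M%:R))//.
    by have := trunc_itv (yM i) => /andP[].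
  rewrite (_ : (M + M)%:R = 2 * M%:R); last by rewrite natrD; ring.
  rewrite ler_wpM2r//.
  by have := hy i; rewrite ler_norml => /andP[_ h]; rewrite -lerBrDr; lra.
exists [ffun i => Ordinal (kM i)].
set j := finfun _.
have Hu := (su _ hy).1; have Huj := (su _ (hyj j)).1.
have Hs : H (\sum_i c j i *: t i) by exact: lin_closed_sum.
rewrite -(subrK (u (yj j)) (u y)) -addrA [leRHS]addrC.
apply: le_trans (form_normD lH sa a0 _ _) _; [exact: lin_closedB..|].
rewrite lerD//.
have := @solves_lipschitz y (yj j) (u y) (u (yj j)) M%:R^-1.
rewrite invr_gt0 => /(_ M0 hy (hyj j) (su _ hy) (su _ (hyj j))) h.
apply: le_trans (h _) _.
  move=> i; rewrite /yj ffunE/= opprB addrA -(ler_pM2r M0) mulVf ?gt_eqF//.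
  rewrite -{2}(gtr0_norm M0) -normrM mulrBl divfK ?gt_eqF//.
  have /andP[h1 h2] := trunc_itv (yM i); rewrite -/(k i) in h1 h2.
  rewrite ler_norml; move: h2; rewrite -natr1 => h2; apply/andP; split; lra.
rewrite mulrC ler_pdivrMr//.
by have := ltW hN; rewrite ler_pdivrMr// mulrC.
Qed.

(** The family is padded with zeros to n vectors, then perturbed so as to satisfy the abstract
    property [Ind]. As only finitely many coefficient vectors occur, a perturbation of size eps / 2
    / (S + 1), with S the sum of all their absolute entries, moves every approximant by at most eps
    / 2. *)
Lemma galerkin_independent (Ind : forall n, ('I_n -> V) -> Prop)
    (u : ('I_p.+1 -> R) -> V) K n (eps : R) :
  (forall (t : 'I_n -> V) eta, (forall i, H (t i)) -> 0 < eta ->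
     exists w, [/\ forall i, H (w i), Ind n w & forall i, nrm (t i - w i) <= eta]) ->
  (num_monomials p K <= n)%N ->
  0 < eps ->
  (forall y, cube y -> solves y (u y)) ->
  exists w : 'I_n -> V, [/\ forall i, H (w i), Ind n w &
  forall y, cube y -> exists c : 'I_n -> R,
    nrm (u y - \sum_i c i *: w i) <= rho ^+ K * (nrm g / (1 - rho)) + eps].
Proof.
move=> hInd Kn eps0 su.
have e2 : 0 < eps / 2 by rewrite divr_gt0.
have [J [t [c [Ht htc]]]] := @galerkin_net u K (eps / 2) e2 su.
pose t' (i : 'I_n) := if insub (i : nat) is Some k then t k else 0.
pose c' j (i : 'I_n) := if insub (i : nat) is Some k then c j k else 0.
have Ht' i : H (t' i) by rewrite /t'; case: insub => [k|]//; exact: lH.1.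
have tE j : \sum_i c j i *: t i = \sum_i c' j i *: t' i.
  have hw i : c' j (widen_ord Kn i) *: t' (widen_ord Kn i) = c j i *: t i.
    rewrite /c' /t' /=; case: insubP => [k _ ki|]; last by rewrite ltn_ord.
    by rewrite (_ : k = i)//; exact/val_inj.
  pose F (i : nat) := if insub i is Some k then c j k *: t k else 0.
  transitivity (\sum_(i < num_monomials p K) F i).
    by apply: eq_bigr => i _; rewrite /F valK.
  rewrite (big_ord_widen _ _ Kn) [LHS]big_mkcond; apply: eq_bigr => i _.
  rewrite /F /c' /t'; case: insubP => [k _ ki|/negbTE ->]; last by rewrite scale0r.
  by rewrite -ki ltn_ord.
pose S := \sum_j \sum_i `|c' j i|.
have S0 : 0 <= S by apply: sumr_ge0 => j _; exact: sumr_ge0.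
have S1 : 0 < S + 1 by rewrite ltr_wpDl.
have eta0 : 0 < eps / 2 / (S + 1) by rewrite divr_gt0.
have [w [Hw iw tw]] := hInd t' _ Ht' eta0.
exists w; split=> // y hy; have [j hj] := htc y hy; exists (c' j).
have Hu := (su _ hy).1.
have Hs : H (\sum_i c j i *: t i) by exact: lin_closed_sum.
have Hsw : H (\sum_i c' j i *: w i) by exact: lin_closed_sum.
rewrite -(subrK (\sum_i c j i *: t i) (u y)) -addrA.
apply: le_trans (form_normD lH sa a0 _ _) _; [exact: lin_closedB..|].
rewrite [eps in leRHS]splitr addrA lerD// tE -sumrB.
under eq_bigr do rewrite -scalerBr.
apply: le_trans (form_norm_sum _ _ lH sa a0 _) _.
  by move=> i; exact: lin_closedB.
apply: (@le_trans _ _ (\sum_i `|c' j i| * (eps / 2 / (S + 1)))).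
  by apply: ler_sum => i _; rewrite ler_wpM2l.
rewrite -mulr_suml mulrA ler_pdivrMr// mulrC ler_wpM2l ?(ltW e2)//.
apply: le_trans (_ : S <= _); last by rewrite lerDl.
rewrite /S (bigD1 j)//= lerDl; apply: sumr_ge0 => l _.
exact: sumr_ge0.
Qed.

End galerkin.

(** * Lebesgue measure on R^m *)

Section rV_measure.
Context {R : realType}.

Definition cube m (c : 'rV[R]_m) (h : R) : set 'rV[R]_m :=
  [set x | forall i, `|x 0 i - c 0 i| < h].

Lemma measurable_cube m (c : 'rV[R]_m) h : measurable (cube c h).
Proof.
rewrite (_ : cube c h = \bigcap_(i in [set: 'I_m])
    (rV_coor i @^-1` [set` `](c 0 i - h), (c 0 i + h)[])).
  apply: fin_bigcap_measurable; first exact: finite_finset.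
  move=> i _; rewrite -[X in measurable X]setTI.
  apply: measurable_rV_coor => //; exact: measurable_itv.
apply/seteqP; split=> [x xc i _|x xc i].
  by have := xc i; rewrite ltr_distl /= in_itv/= /rV_coor.
by have := xc i I; rewrite /= in_itv/= /rV_coor ltr_distl.
Qed.

Lemma lebesgue_cube m (c : 'rV[R]_m) h : 0 < h ->
  lebesgue_rV m (cube c h) = ((h * 2) ^+ m)%:E.
Proof.
move=> h0; elim: m c => [|m IH] c.
  rewrite expr0 /= (_ : cube c h = setT); last by apply/seteqP; split=> // x _ [].
  by rewrite [LHS]diracT.
rewrite /= /lebesgue_step /pushforward.
have -> : @rV_cons R m @^-1` cube c h =
    [set` `](c 0 0 - h), (c 0 0 + h)[] `*`
    cube (\row_i c 0 (rshift 1 i : 'I_m.+1)) h.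
  apply/seteqP; split=> -[x y] /=.
    move=> xy; split=> /=.
      have := xy (lshift m (0 : 'I_1) : 'I_m.+1); rewrite rV_consEl/=.
      rewrite (_ : lshift m 0 = 0); last exact/val_inj.
      by rewrite in_itv/= ltr_distl.
    by move=> i; have := xy (rshift 1 i : 'I_m.+1); rewrite rV_consEr mxE.
  move=> [/= + yc] i; rewrite -(splitK (i : 'I_(1 + m))).
  case: (fintype.split (i : 'I_(1 + m))) => j /=.
    rewrite rV_consEl in_itv/= -ltr_distl.
    by rewrite (_ : lshift m j = 0)//; apply/val_inj; rewrite ord1.
  by move=> _; rewrite rV_consEr/=; have := yc j; rewrite mxE.
rewrite product_measure1E//; last exact: measurable_cube.
rewrite exprS EFinM; congr (_ * _)%E; last exact: IH.
apply: etrans (lebesgue_measure_itv _) _; rewrite /= lte_fin.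
rewrite ltrBlDr -addrA ltrDl addr_gt0// -EFinB; congr EFin; lra.
Qed.

Lemma rV_ballP m (x y : 'rV[R]_m) e : 0 < e ->
  ball x e y <-> cube x e y.
Proof.
move=> e0; split=> [[_ xy] i|xy].
  by have := xy 0 i; rewrite /ball/= distrC.
by split=> // i j; rewrite ord1 /ball/= distrC.
Qed.

Lemma open_cube m (A : set 'rV[R]_m) x : open A -> A x ->
  exists2 h, 0 < h & cube x h `<=` A.
Proof.
move=> oA Ax; have /nbhs_ballP[e e0 eA] : nbhs x A by exact: open_nbhs_nbhs.
by exists e => // y /(rV_ballP _ _ e0); exact: eA.
Qed.

(** The sigma-algebra is generated by the coordinates, so the open set is exhibited as a countable
    union of cubes with rational centres and radii 1/(k + 1). *)
Lemma rV_open_measurable m (A : set 'rV[R]_m) : open A -> measurable A.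
Proof.
move=> oA; pose qc (q : 'rV[rat]_m) : 'rV[R]_m := map_mx ratr q.
pose F (qk : 'rV[rat]_m * nat) := if `[< cube (qc qk.1) qk.2.+1%:R^-1 `<=` A >]
  then cube (qc qk.1) qk.2.+1%:R^-1 else set0.
rewrite (_ : A = \bigcup_qk F qk).
  apply: countable_bigcupT_measurable; first exact: countableP.
  by move=> qk; rewrite /F; case: asboolP => // _; exact: measurable_cube.
apply/seteqP; split=> [x Ax|x [qk _]]; last first.
  by rewrite /F; case: asboolP => // qkA; exact: qkA.
have [h h0 hA] := open_cube oA Ax.
have [k hk] : exists k : nat, 2 / h < k.+1%:R.
  exists (Num.bound (2 / h)); rewrite (lt_le_trans (archi_boundP _))//.
    by rewrite divr_ge0// ltW.
  by rewrite ler_nat.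
(* 2e < h keeps the cube of radius e about a rational point within e of x inside [cube x h]. *)
pose e : R := k.+1%:R^-1; have e0 : 0 < e by rewrite invr_gt0.
have eh : e * 2 < h by rewrite mulrC ltr_pdivrMr// mulrC -ltr_pdivrMr.
have /choice[q hq] (i : 'I_m) : exists q : rat, `|x 0 i - ratr q| < e.
  have /rat_in_itvoo[q] : x 0 i - e < x 0 i + e by lra.
  by rewrite in_itv/= => hq; exists q; rewrite distrC ltr_distl.
have sub : cube (qc (\row_i q i)) e `<=` A.
  move=> y yq; apply: hA => i; have := yq i; rewrite !mxE => yqi.
  rewrite -(subrK (ratr (q i)) (y 0 i)) -addrA (le_lt_trans (ler_normD _ _))//.
  by have := hq i; rewrite distrC; lra.
exists (\row_i q i, k) => //; rewrite /F /=; case: asboolP => //= _ i.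
by rewrite !mxE.
Qed.

Lemma rV_continuous_measurable m (f : 'rV[R]_m -> R) :
  continuous f -> measurable_fun setT f.
Proof.
move=> cf; apply: (measurability _ (RGenOInfty.measurableE R)).
move=> _ [_ [a ->] <-]; rewrite setTI.
apply: rV_open_measurable; apply: open_comp; last exact: interval_open.
by move=> x _; exact: cf.
Qed.

Lemma lebesgue_open_gt0 m (A : set 'rV[R]_m) : open A -> A !=set0 ->
  (0 < lebesgue_rV m A)%E.
Proof.
move=> oA [x Ax]; have [h h0 hA] := open_cube oA Ax.
apply: (@lt_le_trans _ _ (lebesgue_rV m (cube x h))).
  by rewrite lebesgue_cube// lte_fin exprn_gt0// mulr_gt0.
apply: le_measure; rewrite ?inE//; first exact: measurable_cube.
exact: rV_open_measurable.
Qed.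

Lemma rV_bounded_cube m (A : set 'rV[R]_m) : bounded_set A ->
  exists2 M, 0 < M & A `<=` cube 0 M.
Proof.
move=> [M [_ AM]]; exists (`|M| + 2); first by rewrite ltr_wpDl.
move=> x Ax i; rewrite mxE subr0.
have : `|x| <= `|M| + 1 by apply: AM => //; rewrite (le_lt_trans (ler_norm _))// ltrDl.
move=> h; have : `|x 0 i| <= `|x|.
  suff: `|x 0 i| <= mx_norm x by [].
  by rewrite mx_normrE; exact: (le_bigmax _ _ (0, i)).
by lra.
Qed.

Lemma lebesgue_bounded_fin m (A : set 'rV[R]_m) : measurable A ->
  bounded_set A -> (lebesgue_rV m A < +oo)%E.
Proof.
move=> mA /rV_bounded_cube[M M0 AM].
apply: (@le_lt_trans _ _ (lebesgue_rV m (cube 0 M))).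
  by apply: le_measure; rewrite ?inE//; exact: measurable_cube.
by rewrite lebesgue_cube// ltry.
Qed.

End rV_measure.

(** * Compactly supported functions *)

Section compact_support.
Context {R : realType}.

Definition supported_in_cube m (M : R) (G : 'rV[R]_m -> R) :=
  forall x, ~ cube 0 M x -> G x = 0.

Lemma supported_bounded m M (G : 'rV[R]_m -> R) :
  continuous G -> supported_in_cube M G -> exists2 B, 0 <= B & forall x, `|G x| <= B.
Proof.
move=> cG sG.
pose K := [set v : 'rV[R]_m | forall i, `[(- M), M]%classic (v ord0 i)].
have cK : compact K.
  apply: (@rV_compact R m (fun=> `[(- M), M]%classic)) => i.
  exact: segment_compact.
have cGK : compact (G @` K).
  by apply: continuous_compact cK; exact: continuous_subspaceT.
have [B [_ hB]] := compact_bounded cGK.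
exists (`|B| + 1); first by rewrite addr_ge0.
move=> x; have [xM|xM] := pselect (cube 0 M x); last by rewrite sG// normr0 addr_ge0.
apply: hB; first by rewrite (le_lt_trans (ler_norm _))// ltrDl.
exists x => // i; rewrite /= in_itv/= -ler_norml.
by have := xM i; rewrite mxE subr0 => /ltW.
Qed.

Lemma bounded_integrable m (D : set 'rV[R]_m) (G : 'rV[R]_m -> R) B :
  measurable D -> (lebesgue_rV m D < +oo)%E -> measurable_fun D G ->
  (forall x, `|G x| <= B) ->
  (lebesgue_rV m).-integrable D (EFin \o G).
Proof.
move=> mD Dfin mG GB; apply: measurable_bounded_integrable => //.
exists B; split; rewrite ?num_real// => y By x _ /=.
exact: le_trans (GB x) (ltW By).
Qed.

Lemma supported_integrable m M (G : 'rV[R]_m -> R) : 0 < M ->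
  continuous G -> supported_in_cube M G ->
  (lebesgue_rV m).-integrable setT (EFin \o G).
Proof.
move=> M0 cG sG; have [B B0 GB] := supported_bounded cG sG.
have -> : EFin \o G = (EFin \o G) \_ (cube 0 M).
  apply/funext => x; rewrite patchE; case: ifPn => //.
  by rewrite notin_setE => /sG; rewrite /= => ->.
apply: (iffLR (integrable_mkcond _ (measurable_cube _ _))).
apply: (@bounded_integrable _ _ _ B) => //.
- exact: measurable_cube.
- by rewrite lebesgue_cube// ltry.
- by apply: measurable_funTS; exact: rV_continuous_measurable.
Qed.

Lemma rV_cons_continuousr m (x : R) : continuous (fun y : 'rV[R]_m => rV_cons (x, y)).
Proof.
move=> y A /nbhs_ballP[e e0 eA]; apply/nbhs_ballP; exists e => //= y' [_ yy'].
apply: eA; split=> // i j; rewrite (ord1 i).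
rewrite -(splitK (j : 'I_(1 + m))); case: (fintype.split (j : 'I_(1 + m))) => k /=.
  by rewrite !rV_consEl; exact: ballxx.
by rewrite !rV_consEr; exact: yy'.
Qed.

Lemma rV_cons_continuousl m (y : 'rV[R]_m) :
  continuous (fun x : R => rV_cons (x, y)).
Proof.
move=> x A /nbhs_ballP[e e0 eA]; apply/nbhs_ballP; exists e => //= x' xx'.
apply: eA; split=> // i j; rewrite (ord1 i).
rewrite -(splitK (j : 'I_(1 + m))); case: (fintype.split (j : 'I_(1 + m))) => k /=.
  by rewrite !rV_consEl; exact: xx'.
by rewrite !rV_consEr; exact: ballxx.
Qed.

Lemma rV_cons_add0 m (h x : R) (y : 'rV[R]_m) :
  h *: delta_mx 0 0 + rV_cons (x, y) = rV_cons (h + x, y) :> 'rV[R]_m.+1.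
Proof.
apply/rowP => j; rewrite [LHS]mxE [X in X + _]mxE [X in _ * X + _]mxE -(splitK (j : 'I_(1 + m))).
case: (fintype.split (j : 'I_(1 + m))) => k /=.
  by rewrite !rV_consEl/= (_ : _ == _) ?mulr1//; apply/eqP/val_inj; rewrite ord1.
by rewrite !rV_consEr/= mulr0 add0r.
Qed.

Lemma rV_cons_addr m (h x : R) (y : 'rV[R]_m) (i : 'I_m) :
  h *: delta_mx 0 (rshift 1 i) + rV_cons (x, y) =
  rV_cons (x, h *: delta_mx 0 i + y) :> 'rV[R]_m.+1.
Proof.
apply/rowP => j; rewrite [LHS]mxE [X in X + _]mxE [X in _ * X + _]mxE -(splitK (j : 'I_(1 + m))).
case: (fintype.split (j : 'I_(1 + m))) => k /=.
  by rewrite !rV_consEl/= eq_lrshift mulr0 add0r.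
by rewrite !rV_consEr/= [RHS]mxE [X in _ = X + _]mxE [X in _ = _ * X + _]mxE /= eq_rshift.
Qed.

Lemma supported_FTC (f : R -> R) (M : R) : 0 < M -> (forall x, derivable f x 1) ->
  continuous (derive1 f) -> (forall x, M <= `|x| -> f x = 0) ->
  (forall x, M <= `|x| -> derive1 f x = 0) ->
  (\int[lebesgue_measure]_x (derive1 f x)%:E = 0)%E.
Proof.
move=> M0 df cf f0 f'0.
have -> : (\int[lebesgue_measure]_x (derive1 f x)%:E =
    \int[lebesgue_measure]_(x in `[(- M)%R, M]) (derive1 f x)%:E)%E.
  rewrite [RHS]integral_mkcond; apply: eq_integral => x _.
  rewrite patchE; case: ifPn => //; rewrite notin_setE/= in_itv/= => /negP.
  by rewrite -ler_norml -ltNge => /ltW /f'0 ->.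
have fc : continuous f.
  by move=> x; apply/differentiable_continuous/derivable1_diffP.
rewrite (@continuous_FTC2 _ _ f)//; last 3 first.
- by rewrite ltrNl (lt_trans _ M0)// oppr_lt0.
- exact: continuous_subspaceT.
- by split=> [x _|//|//]; [exact: df| exact/cvg_at_right_filter/fc|
    exact/cvg_at_left_filter/fc].
by rewrite !f0 ?sube0// ?normrN ger0_norm// ltW.
Qed.

(* Only derivability along the axes is required, so that the class is stable under slicing. *)
Lemma integral_partial_eq0 m (F : 'rV[R]_m -> R) (i : 'I_m) M : 0 < M ->
  (forall x j, derivable F x (delta_mx 0 j)) ->
  (forall j, continuous (partial j F)) -> supported_in_cube M F ->
  (forall j, supported_in_cube M (partial j F)) ->
  (\int[lebesgue_rV m]_x (partial i F x)%:E = 0)%E.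
Proof.
move=> M0; elim: m F i => [F []//|m IH F i dF cF sF sF'].
have iF := supported_integrable M0 (cF i) (sF' i).
have mcF : measurable_fun setT (EFin \o partial i F).
  by apply/measurable_EFinP; exact: rV_continuous_measurable.
have iFc : (@lebesgue_measure R \x lebesgue_rV m)%E.-integrable setT
    ((EFin \o partial i F) \o @rV_cons R m).
  have /integrableP[_] := iF; rewrite /= /lebesgue_step => iFoo.
  apply/integrableP; split; first by apply: measurableT_comp => //; exact: measurable_rV_cons.
  apply: le_lt_trans iFoo; rewrite ge0_integral_pushforward//.
  - exact: measurable_rV_cons.
  - apply/measurable_EFinP; apply: measurableT_comp => //.
    exact: rV_continuous_measurable.
apply: etrans (integral_pushforward (@measurable_rV_cons R m) mcF iFc measurableT) _.
rewrite preimage_setT; move: iFc {mcF iF}; rewrite -(splitK (i : 'I_(1 + m))).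
case: (fintype.split (i : 'I_(1 + m))) => k /= iFc.
  (* Derivative in the first coordinate: integrated over innermost, it gives zero on each line by
     the fundamental theorem of calculus. *)
  rewrite -integral21_prod_meas1//.
  apply: integral0_eq => y _; rewrite /fubini_G/=.
  have k0 : lshift m k = 0 by apply/val_inj; rewrite ord1.
  pose f (x : R) := F (rV_cons (x, y)).
  have lim x h : h^-1 *: (f (h *: 1 + x) - f x) =
      h^-1 *: (F (h *: delta_mx 0 0 + rV_cons (x, y)) - F (rV_cons (x, y))).
    by rewrite rV_cons_add0 /f scaler1.
  have df x : derivable f x 1.
    have := dF (rV_cons (x, y)) 0; rewrite /derivable.
    by under eq_fun do rewrite -lim.
  have f'E : derive1 f = fun x => partial 0 F (rV_cons (x, y)).
    apply/funext => x; rewrite derive1E /partial /derive.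
    by under eq_fun do rewrite lim.
  have out x : M <= `|x| -> ~ cube 0 M (rV_cons (x, y)).
    move=> Mx /(_ (lshift m (0 : 'I_1) : 'I_m.+1)); rewrite rV_consEl mxE subr0 /=.
    by rewrite ltNge Mx.
  rewrite k0; transitivity (\int[lebesgue_measure]_x (derive1 f x)%:E)%E.
    by rewrite f'E.
  apply: (supported_FTC M0) => //.
  - rewrite f'E => x; apply: continuous_comp; first exact: rV_cons_continuousl.
    exact: cF.
  - by move=> x /out; exact: sF.
  - by move=> x /out; rewrite f'E; exact: sF'.
(* Derivative in another coordinate: the induction hypothesis applies on each slice with the first
   coordinate fixed. *)
rewrite -integral12_prod_meas1//.
apply: integral0_eq => x _; rewrite /fubini_F/=.
pose G (y : 'rV[R]_m) := F (rV_cons (x, y)).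
have lim y j h : h^-1 *: (G (h *: delta_mx 0 j + y) - G y) =
    h^-1 *: (F (h *: delta_mx 0 (rshift 1 j) + rV_cons (x, y)) - F (rV_cons (x, y))).
  by rewrite rV_cons_addr.
have G'E j : partial j G = fun y => partial (rshift 1 j) F (rV_cons (x, y)).
  apply/funext => y; rewrite /partial /derive.
  by under eq_fun do rewrite lim.
have out (y : 'rV[R]_m) : ~ cube 0 M y -> ~ cube 0 M (rV_cons (x, y)).
  move=> yM xyM; apply: yM => j; have := xyM (rshift 1 j : 'I_m.+1).
  by rewrite rV_consEr !mxE.
transitivity (\int[lebesgue_rV m]_y (partial k G y)%:E)%E; first by rewrite G'E.
apply: IH.
- move=> y j; have := dF (rV_cons (x, y)) (rshift 1 j); rewrite /derivable.
  by under eq_fun do rewrite -lim.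
- move=> j; rewrite G'E => y; apply: continuous_comp.
    exact: rV_cons_continuousr.
  exact: cF.
- by move=> y /out; exact: sF.
- by move=> j y /out; rewrite G'E; exact: sF'.
Qed.

End compact_support.

(** * Square-integrable functions and diffusion forms *)

Section L2.
Context {R : realType} {m : nat} (D : set 'rV[R]_m) (mD : measurable D).
Local Notation mu := (@lebesgue_rV R m).
Local Notation integrableD_ f := (mu.-integrable D (EFin \o f)).
Implicit Types (f g h a : 'rV[R]_m -> R).

Lemma Lp_on_lin (p : \bar R) c f g : (1 <= p)%E ->
  Lp_on D p f -> Lp_on D p g -> Lp_on D p (c *: f + g).
Proof.
move=> p1 lf lg; rewrite /Lp_on.
have -> : (c *: f + g) \_ D = c *: (f \_ D) + g \_ D.
  apply/funext => x; rewrite !fctE /patch; case: ifP => // _.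
  by rewrite scaler0 addr0.
have [_ h] := @Lfun_submod_closed _ _ _ mu p p1; exact: (h c _ _ lf lg).
Qed.

Lemma Lp_on0 (p : \bar R) : (1 <= p)%E -> Lp_on D p 0.
Proof.
move=> p1; rewrite /Lp_on (_ : _ \_ _ = 0).
  by have [h _] := @Lfun_submod_closed _ _ _ mu p p1; exact: h.
by apply/funext => x; rewrite /patch; case: ifP.
Qed.

Lemma Lp_on_measurable (p : \bar R) f : Lp_on D p f -> measurable_fun D f.
Proof.
rewrite /Lp_on inE => /andP[+ _]; rewrite inE/= => mf.
exact: (iffRL (measurable_restrictT _ mD)).
Qed.

Lemma Lp_on2M f g : Lp_on D 2%:E f -> Lp_on D 2%:E g ->
  integrableD_ (fun x => f x * g x).
Proof.
move=> lf lg; have /Lfun1_integrable h := Lfun2_mul_Lfun1 lf lg.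
apply: (iffRL (integrable_mkcond _ mD)).
congr (mu.-integrable setT _): h.
apply/funext => x; rewrite /patch /=; case: ifP => // _.
by rewrite mulr0.
Qed.

Lemma bounded_Lp_on2 f B : (mu D < +oo)%E -> measurable_fun D f ->
  (forall x, `|f x| <= B) -> Lp_on D 2%:E f.
Proof.
move=> Dfin mf fB; rewrite /Lp_on inE; apply/andP; split; rewrite inE/=.
  exact: (iffLR (measurable_restrictT _ mD)).
rewrite /finite_norm unlock poweR_lty//.
have -> : (\int[mu]_x `|(EFin \o f \_ D) x| `^ 2 = \int[mu]_(x in D) (f x ^+ 2)%:E)%E.
  rewrite [RHS]integral_mkcond; apply: eq_integral => x _ /=.
  rewrite /patch; case: ifP => _ /=.
    by rewrite powR_mulrn// real_normK ?num_real.
  by rewrite normr0 powR0// pnatr_eq0.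
apply: integrable_lty => //.
apply: (@bounded_integrable _ _ _ _ (B ^+ 2)) => //; first exact: measurable_funX.
by move=> x; rewrite normrX ler_pXn2r// nnegrE ?(le_trans _ (fB x)).
Qed.

(** The norm at +oo is the essential supremum only when the total mass is positive, whence the first
    hypothesis. *)
Lemma Linf_ae a : (0 < mu setT)%E -> Lp_on D +oo%E a ->
  {ae mu, forall x, D x -> `|a x| <= Linf_norm D a}.
Proof.
move=> mu0 la.
have Lfin : 'N[mu]_+oo[EFin \o (a \_ D)]%E \is a fin_num.
  rewrite ge0_fin_numE ?Lnorm_ge0//.
  by move: la; rewrite /Lp_on inE => /andP[_]; rewrite inE.
have := ess_sup_ge mu (abse \o (EFin \o (a \_ D))).
apply: filterS => x /= h Dx; rewrite -lee_fin /Linf_norm fineK//.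
rewrite unlock mu0; apply: le_trans h; rewrite /patch mem_set//.
Qed.

Lemma Linf_mul_integrable a h : (0 < mu setT)%E -> Lp_on D +oo%E a ->
  integrableD_ h -> integrableD_ (fun x => a x * h x).
Proof.
move=> mu0 la ih; have [mh _] := integrableP _ _ _ ih.
have ma := Lp_on_measurable la.
have mh' : measurable_fun D h by exact/measurable_EFinP.
have mah : measurable_fun D (fun x => a x * h x) by exact: measurable_funM.
apply/integrableP; split; first exact/measurable_EFinP.
have iLh := integrableZl mD (Linf_norm D a) ih.
have [mLh] := integrableP _ _ _ iLh; apply: le_lt_trans.
apply: ae_ge0_le_integral => //.
- by apply: measurableT_comp => //; exact/measurable_EFinP.
- exact: measurableT_comp.
apply: filterS (Linf_ae mu0 la) => x ax Dx /=.
by rewrite lee_fin !normrM ler_wpM2r// (le_trans (ax Dx))// ler_norm.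
Qed.

(** Almost everywhere g - f equals |g - f|, whose integral is nonnegative. *)
Lemma ae_le_Rintegral f g : integrableD_ f -> integrableD_ g ->
  {ae mu, forall x, D x -> f x <= g x} ->
  \int[mu]_(x in D) f x <= \int[mu]_(x in D) g x.
Proof.
move=> iF ig fg; rewrite -subr_ge0 -RintegralB//.
have [mf _] := integrableP _ _ _ iF; have [mg _] := integrableP _ _ _ ig.
have mgf : measurable_fun D (fun x => g x - f x).
  by apply: measurable_funB; exact/measurable_EFinP.
rewrite (_ : \int[mu]_(x in D) (g x - f x) = \int[mu]_(x in D) `|g x - f x|).
  by apply: Rintegral_ge0.
congr fine; apply: ae_eq_integral => //.
- exact/measurable_EFinP.
- by apply/measurable_EFinP; exact: measurableT_comp.
- apply: filterS fg => x fgx Dx /=.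
  by rewrite ger0_norm// subr_ge0 fgx.
Qed.

Lemma integrable_lin c f g : integrableD_ f -> integrableD_ g ->
  integrableD_ (fun x => c * f x + g x).
Proof.
move=> iF ig.
by have := integrableD mD (integrableZl mD c iF) ig.
Qed.

Lemma Rintegral_lin c f g : integrableD_ f -> integrableD_ g ->
  \int[mu]_(x in D) (c * f x + g x) =
  c * \int[mu]_(x in D) f x + \int[mu]_(x in D) g x.
Proof.
move=> iF ig; rewrite RintegralD//; last first.
  by have := integrableZl mD c iF.
by rewrite RintegralZl.
Qed.

Definition grad_L2 (v : @sobolev R m) :=
  forall i, Lp_on D 2%:E (fun x => v.2 x 0 i).

Lemma dot_integrable (u v : @sobolev R m) : grad_L2 u -> grad_L2 v ->
  integrableD_ (fun x => dot (u.2 x) (v.2 x)).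
Proof.
move=> lu lv; rewrite (_ : _ \o _ = fun x =>
    (\sum_i (u.2 x 0 i * v.2 x 0 i)%:E)%E); last first.
  by apply/funext => x; rewrite sumEFin.
by apply: integrable_sum => // i _; exact: Lp_on2M.
Qed.

Lemma dot_lin (c : R) (x y z : 'rV[R]_m) : dot (c *: x + y) z = c * dot x z + dot y z.
Proof.
rewrite /dot mulr_sumr -big_split; apply: eq_bigr => i _.
by rewrite !mxE /= mulrDl mulrA.
Qed.

Lemma dotC (x y : 'rV[R]_m) : dot x y = dot y x.
Proof. by apply: eq_bigr => i _; rewrite mulrC. Qed.

Lemma dot_ge0 (x : 'rV[R]_m) : 0 <= dot x x.
Proof. by apply: sumr_ge0 => i _; rewrite -expr2 sqr_ge0. Qed.

Lemma diffusion_integrable a (u v : @sobolev R m) : (0 < mu setT)%E ->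
  Lp_on D +oo%E a -> grad_L2 u -> grad_L2 v ->
  integrableD_ (fun x => a x * dot (u.2 x) (v.2 x)).
Proof. by move=> *; apply: Linf_mul_integrable => //; exact: dot_integrable. Qed.

Lemma grad_L2_lin : lin_closed grad_L2.
Proof.
split=> [i|c u v lu lv i].
  rewrite (_ : (fun x => _) = 0); last by apply/funext => x; rewrite /= mxE.
  by apply: Lp_on0; exact: lee1n.
have -> : (fun x => (c *: u + v).2 x 0 i) =
  c *: (fun x => u.2 x 0 i) + (fun x => v.2 x 0 i).
  by apply/funext => x; rewrite /= !fctE !mxE.
by apply: Lp_on_lin => //; exact: lee1n.
Qed.

Lemma diffusion_sym_form a : (0 < mu setT)%E -> Lp_on D +oo%E a ->
  sym_form grad_L2 (diffusion D a).
Proof.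
move=> mu0 la; split=> [u v _ _|c u v w lu lv lw].
  by apply: eq_Rintegral => x _; rewrite dotC.
rewrite /diffusion -Rintegral_lin//; [|exact: diffusion_integrable..].
apply: eq_Rintegral => x _; rewrite /= !fctE dot_lin; ring.
Qed.

Lemma Lp_on_cst1 : Lp_on D +oo%E (cst 1).
Proof.
rewrite /Lp_on inE; apply/andP; split; rewrite inE/=.
  by apply: (iffLR (measurable_restrictT _ mD)); exact: measurable_cst.
rewrite /finite_norm unlock; case: ifP => // _.
apply: (@le_lt_trans _ _ 1%:E); last exact: ltry.
apply/ess_supP; apply: nearW => x /=; rewrite lee_fin /patch.
by case: ifP => _; rewrite ?normr1 ?normr0.
Qed.

Lemma V_normE v : V_norm D v = form_norm (diffusion D (cst 1)) v.
Proof.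
rewrite /V_norm /form_norm /diffusion; congr Num.sqrt.
by apply: eq_Rintegral => x _; rewrite mul1r.
Qed.

Lemma diffusion_le a b v : (0 < mu setT)%E -> Lp_on D +oo%E a ->
  Lp_on D +oo%E b -> grad_L2 v -> {ae mu, forall x, D x -> a x <= b x} ->
  diffusion D a v v <= diffusion D b v v.
Proof.
move=> mu0 la lb lv ab; apply: ae_le_Rintegral; [exact: diffusion_integrable..|].
by apply: filterS ab => x abx Dx; rewrite ler_wpM2r ?dot_ge0// abx.
Qed.

Lemma diffusion_coef_lin c a b u v : (0 < mu setT)%E -> Lp_on D +oo%E a ->
  Lp_on D +oo%E b -> grad_L2 u -> grad_L2 v ->
  diffusion D (c *: a + b) u v = c * diffusion D a u v + diffusion D b u v.
Proof.
move=> mu0 la lb lu lv; rewrite /diffusion -Rintegral_lin//;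
  [|exact: diffusion_integrable..].
by apply: eq_Rintegral => x _; rewrite !fctE mulrDl mulrA.
Qed.

Lemma Lp_on_sum (p : \bar R) (I : finType) (c : I -> R) (f : I -> 'rV[R]_m -> R) :
  (1 <= p)%E -> (forall i, Lp_on D p (f i)) -> Lp_on D p (\sum_i c i *: f i).
Proof.
move=> p1 lf; elim/big_ind: _ => [|g h lg lh|i _].
- exact: Lp_on0.
- by rewrite -[g]scale1r; exact: Lp_on_lin.
- by rewrite -[_ *: _]addr0; apply: Lp_on_lin => //; exact: Lp_on0.
Qed.

Lemma diffusion_coef_sum (I : finType) (c : I -> R) (f : I -> 'rV[R]_m -> R) u v :
  (0 < mu setT)%E -> (forall i, Lp_on D +oo%E (f i)) -> grad_L2 u -> grad_L2 v ->
  diffusion D (\sum_i c i *: f i) u v = \sum_i c i * diffusion D (f i) u v.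
Proof.
move=> mu0 lf lu lv; rewrite /diffusion.
transitivity (\int[mu]_(x in D) \sum_i c i * (f i x * dot (u.2 x) (v.2 x))).
  apply: eq_Rintegral => x _; rewrite fct_sumE mulr_suml.
  by apply: eq_bigr => i _; rewrite !fctE mulrA.
elim: (index_enum I) => [|i s IH].
  by rewrite big_nil; under eq_Rintegral do rewrite big_nil; rewrite Rintegral_cst// mul0r.
rewrite big_cons -IH -Rintegral_lin//.
- by apply: eq_Rintegral => x _; rewrite big_cons.
- exact: diffusion_integrable.
- rewrite (_ : _ \o _ = fun x =>
    (\sum_(j <- s) (c j * (f j x * dot (u.2 x) (v.2 x)))%:E)%E); last first.
    by apply/funext => x; rewrite sumEFin.
  apply: integrable_sum => // j _.
  by have := integrableZl mD (c j) (diffusion_integrable mu0 (lf j) lu lv).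
Qed.

End L2.

(** * Test functions and H^1_0 *)

Section smooth.
Context {R : realType} {m : nat}.
Implicit Types f g : 'rV[R]_m -> R.

Lemma smooth_partial i f : smooth f -> smooth (partial i f).
Proof. by move=> sf s x; have := sf (rcons s i) x; rewrite foldr_rcons. Qed.

Lemma smooth_differentiable f x : smooth f -> differentiable f x.
Proof. by move=> /(_ [::]). Qed.

Lemma smooth_continuous f : smooth f -> continuous f.
Proof. by move=> sf x; exact/differentiable_continuous/smooth_differentiable. Qed.

Lemma smooth_derivable f x v : smooth f -> derivable f x v.
Proof. by move=> sf; exact/diff_derivable/smooth_differentiable. Qed.

Lemma partial_lin i c f g : smooth f -> smooth g ->
  partial i (c *: f + g) = c *: partial i f + partial i g.
Proof.
move=> sf sg; apply/funext => x.
have df := @smooth_derivable _ x (delta_mx 0 i) sf.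
have dg := @smooth_derivable _ x (delta_mx 0 i) sg.
have dcf := @derivableZ _ _ _ f c x _ df.
have E := deriveD dcf dg; rewrite deriveZ// in E; exact: E.
Qed.

Lemma smooth_lin c f g : smooth f -> smooth g -> smooth (c *: f + g).
Proof.
move=> sf sg s x.
have [sf' [sg' ->]] : smooth (foldr partial f s) /\ smooth (foldr partial g s) /\
    foldr partial (c *: f + g) s = c *: foldr partial f s + foldr partial g s.
  elim: s => [//|i s [sf' [sg' IH]]] /=; split; [exact: smooth_partial|split].
    exact: smooth_partial.
  by rewrite IH partial_lin.
by apply: differentiableD; [apply: differentiableZ|]; exact: smooth_differentiable.
Qed.

Lemma partial_cst i (c : R) : partial i (cst c : 'rV[R]_m -> R) = cst 0.
Proof. by apply/funext => x; rewrite /partial derive_cst. Qed.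

Lemma smooth_cst (c : R) : smooth (cst c : 'rV[R]_m -> R).
Proof.
move=> s x; have [c' ->] : exists c', foldr partial (cst c : 'rV[R]_m -> R) s = cst c'.
  elim: s => [|i s [c' IH]]; first by exists c.
  by exists 0; rewrite /= IH partial_cst.
exact: differentiable_cst.
Qed.

Lemma partialM i f g : smooth f -> smooth g ->
  partial i (fun x => f x * g x) = fun x => f x * partial i g x + partial i f x * g x.
Proof.
move=> sf sg; apply/funext => x; rewrite /partial.
have df := @smooth_derivable _ x (delta_mx 0 i) sf.
have dg := @smooth_derivable _ x (delta_mx 0 i) sg.
by rewrite (deriveM df dg) /= /GRing.scale /= [X in _ + X]mulrC.
Qed.

End smooth.

Section test_functions.
Context {R : realType} {m : nat} (D : set 'rV[R]_m).
Local Notation mu := (@lebesgue_rV R m).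

Lemma test_smooth phi : test_function D phi -> smooth phi.
Proof. by case. Qed.

Lemma test_continuous phi : test_function D phi -> continuous phi.
Proof. by move=> /test_smooth; exact: smooth_continuous. Qed.

Lemma test_partial_continuous phi i : test_function D phi -> continuous (partial i phi).
Proof. by move=> /test_smooth sp; exact/smooth_continuous/smooth_partial. Qed.

(** The complement of the closed support is open, and phi vanishes identically there. *)
Lemma partial_supp (phi : 'rV[R]_m -> R) i x :
  ~ closure [set x | phi x != 0] x -> partial i phi x = 0.
Proof.
move=> xs; have o : open (~` closure [set x | phi x != 0]).
  exact/closed_openC/closed_closure.
rewrite /partial (@near_eq_derive _ _ _ _ (cst 0)) ?derive_cst//.
apply: filterS (open_nbhs_nbhs (conj o xs)) => y ys /=.
by apply/eqP; apply: contra_notT ys => py; exact: subset_closure.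
Qed.

Lemma test_out phi x : test_function D phi -> ~ D x -> phi x = 0.
Proof.
move=> [_ _ sD] Dx; apply/eqP; apply: contra_notT Dx => px; apply: sD.
exact: subset_closure.
Qed.

Lemma test_partial_out phi i x : test_function D phi -> ~ D x -> partial i phi x = 0.
Proof. by move=> [_ _ sD] Dx; apply: partial_supp => /sD. Qed.

Lemma test_cube phi : test_function D phi -> exists M, [/\ 0 < M,
  supported_in_cube M phi & forall i, supported_in_cube M (partial i phi)].
Proof.
move=> [_ cS _]; have [M M0 SM] := rV_bounded_cube (compact_bounded cS).
exists M; split=> [//|x xM|i x xM].
  apply/eqP; apply: contra_notT xM => px; apply: SM; exact: subset_closure.
by apply: partial_supp => /SM.
Qed.

Lemma test_bounded phi : test_function D phi -> exists B, forall x, `|phi x| <= B.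
Proof.
move=> tp; have [M [_ sM _]] := test_cube tp.
by have [B _ hB] := supported_bounded (test_continuous tp) sM; exists B.
Qed.

Lemma test_partial_bounded phi i : test_function D phi ->
  exists B, forall x, `|partial i phi x| <= B.
Proof.
move=> tp; have [M [_ _ sM]] := test_cube tp.
by have [B _ hB] := supported_bounded (test_partial_continuous tp) (sM i); exists B.
Qed.

Lemma test_lin c phi psi : test_function D phi -> test_function D psi ->
  test_function D (c *: phi + psi).
Proof.
move=> [sp cp pD] [sq cq qD].
have sub : closure [set x | (c *: phi + psi) x != 0] `<=`
    closure [set x | phi x != 0] `|` closure [set x | psi x != 0].
  rewrite -closureU; apply: closure_subset => x /=; rewrite !fctE.
  have [->|px] := eqVneq (phi x) 0; last by left.
  by rewrite scaler0 add0r; right.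
split; first exact: smooth_lin.
- apply: (subclosed_compact _ (compactU cp cq) sub); exact: closed_closure.
- by move=> x /sub[/pD|/qD].
Qed.

Lemma test0 : test_function D 0.
Proof.
split; first exact: (smooth_cst 0).
- rewrite (_ : [set x | _] = set0) ?closure0//; first exact: compact0.
  by apply/seteqP; split=> // x /=; rewrite eqxx.
- rewrite (_ : [set x | _] = set0) ?closure0//.
  by apply/seteqP; split=> // x /=; rewrite eqxx.
Qed.

Context (mD : measurable D) (Dfin : (mu D < +oo)%E).

Lemma test_Lp phi : test_function D phi -> Lp_on D 2%:E phi.
Proof.
move=> tp; have [B hB] := test_bounded tp.
apply: (@bounded_Lp_on2 _ _ _ mD _ B) => //.
by apply: measurable_funTS; apply: rV_continuous_measurable; exact: test_continuous tp.
Qed.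

Lemma test_partial_Lp phi i : test_function D phi -> Lp_on D 2%:E (partial i phi).
Proof.
move=> tp; have [B hB] := test_partial_bounded i tp.
apply: (@bounded_Lp_on2 _ _ _ mD _ B) => //.
apply: measurable_funTS; apply: rV_continuous_measurable.
exact: test_partial_continuous tp.
Qed.

(** Integration by parts: phi psi has compact support, so its partial derivatives integrate to zero
    over R^m, and outside D both terms of the product rule vanish. *)
Lemma of_test_weak_gradient phi : test_function D phi ->
  weak_gradient D (of_test phi).1 (of_test phi).2.
Proof.
move=> tp psi i tq /=.
have sp := test_smooth tp; have sq := test_smooth tq.
have [M [M0 pM p'M]] := test_cube tp.
have I0 : (\int[mu]_x (partial i (fun x => phi x * psi x) x)%:E = 0)%E.
  apply: (integral_partial_eq0 _ M0).
  - by move=> x j; apply: derivableM; exact: smooth_derivable.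
  - move=> j; rewrite partialM// => x.
    have c1 := continuousM (@test_continuous _ tp x) (@test_partial_continuous _ j tq x).
    have c2 := continuousM (@test_partial_continuous _ j tp x) (@test_continuous _ tq x).
    exact: continuousD c1 c2.
  - by move=> x xM; rewrite pM// mul0r.
  - by move=> j x xM; rewrite partialM// pM// p'M// !mul0r addr0.
have : \int[mu]_(x in D) (phi x * partial i psi x + partial i phi x * psi x) = 0.
  rewrite /Rintegral integral_mkcond (_ : integral _ _ _ = 0%E)// -I0.
  apply: eq_integral => x _; rewrite partialM// /patch; case: ifPn => //.
  rewrite notin_setE => Dx.
  by rewrite (test_out tp)// (test_partial_out _ tp)// !mul0r addr0.
rewrite RintegralD//; last 2 first.
- by apply: Lp_on2M => //; [exact: test_Lp|exact: test_partial_Lp].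
- by apply: Lp_on2M => //; [exact: test_partial_Lp|exact: test_Lp].
move/eqP; rewrite addr_eq0 => /eqP ->; congr (- _).
by apply: eq_Rintegral => x _; rewrite mxE.
Qed.

Lemma H1_of_test phi : test_function D phi -> H1 D (of_test phi).
Proof.
move=> tp; split; [exact: test_Lp| |exact: of_test_weak_gradient].
move=> i; rewrite (_ : (fun x => _) = partial i phi); first exact: test_partial_Lp.
by apply/funext => x; rewrite /= mxE.
Qed.

Lemma of_test_lin c phi psi : test_function D phi -> test_function D psi ->
  of_test (c *: phi + psi) = c *: of_test phi + of_test psi.
Proof.
move=> tp tq; congr (_, _); apply/funext => x; apply/rowP => i.
by rewrite !mxE partial_lin//; exact: test_smooth.
Qed.

Lemma H1_lin : lin_closed (H1 D).
Proof.
have l2 : (1 <= 2%:E :> \bar R)%E by exact: lee1n.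
split.
  split=> [|i|].
  - exact: Lp_on0.
  - by have [h _] := @grad_L2_lin R m D; exact: (h i).
  - move=> phi i tp /=; under eq_Rintegral do rewrite mul0r.
    under [in RHS]eq_Rintegral do rewrite mxE mul0r.
    by rewrite !Rintegral_cst// mul0r oppr0.
move=> c u v [lu gu wu] [lv gv wv]; split.
- exact: Lp_on_lin.
- by have [_ h] := @grad_L2_lin R m D; exact: (h c u v gu gv).
- move=> phi i tp /=.
  have tpL := test_Lp tp; have tp'L := test_partial_Lp i tp.
  transitivity (\int[mu]_(x in D)
      (c * (u.1 x * partial i phi x) + v.1 x * partial i phi x)).
    by apply: eq_Rintegral => x _; rewrite !fctE mulrDl mulrA.
  rewrite Rintegral_lin//; [|exact: Lp_on2M..].
  rewrite wu// wv//.
  transitivity (- \int[mu]_(x in D)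
      (c * (u.2 x 0 i * phi x) + v.2 x 0 i * phi x)); last first.
    by congr (- _); apply: eq_Rintegral => x _; rewrite !fctE !mxE mulrDl mulrA.
  rewrite Rintegral_lin//; [|exact: Lp_on2M..].
  by rewrite mulrN opprD.
Qed.

Definition H1_form (u v : @sobolev R m) : R :=
  \int[mu]_(x in D) (u.1 x * v.1 x + dot (u.2 x) (v.2 x)).

Lemma H1_form_integrable u v : H1 D u -> H1 D v ->
  mu.-integrable D (EFin \o (fun x => u.1 x * v.1 x + dot (u.2 x) (v.2 x))).
Proof.
move=> [lu gu _] [lv gv _].
have := integrable_lin mD 1 (Lp_on2M mD lu lv) (dot_integrable mD gu gv).
by congr (mu.-integrable D _); apply/funext => x; rewrite /= mul1r.
Qed.

Lemma H1_form_sym : sym_form (H1 D) H1_form.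
Proof.
split=> [u v _ _|c u v w hu hv hw].
  by apply: eq_Rintegral => x _; rewrite mulrC dotC.
rewrite /H1_form -Rintegral_lin//; [|exact: H1_form_integrable..].
apply: eq_Rintegral => x _; rewrite /= !fctE dot_lin mulrDl.
by rewrite mulrDr -scalerAl addrACA.
Qed.

Lemma H1_form_ge0 v : 0 <= H1_form v v.
Proof. by apply: Rintegral_ge0 => x _; rewrite addr_ge0 ?dot_ge0// -expr2 sqr_ge0. Qed.

Lemma H1_normE v : H1_norm D v = form_norm H1_form v.
Proof.
congr Num.sqrt; apply: eq_Rintegral => x _; by rewrite expr2.
Qed.

Lemma H10_of_test phi : test_function D phi -> H10 D (of_test phi).
Proof.
move=> tp; split; first exact: H1_of_test.
move=> e e0; exists phi => //; rewrite subrr H1_normE.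
by rewrite (form_norm0 H1_lin H1_form_sym).
Qed.

Lemma H10_lin : lin_closed (H10 D).
Proof.
have l1 := H1_lin; have sf := H1_form_sym.
have f0 v : H1 D v -> 0 <= H1_form v v by move=> _; exact: H1_form_ge0.
split.
  have := H10_of_test test0; rewrite (_ : of_test 0 = 0)//.
  congr (_, _); apply/funext => x; apply/rowP => i; rewrite !mxE.
  by rewrite (_ : 0 = cst 0)// partial_cst.
move=> c u v [hu au] [hv av]; split; first exact: l1.2.
move=> e e0; have e2 : 0 < e / 2 by rewrite divr_gt0.
have c1 : 0 < `|c| + 1 by rewrite ltr_wpDl.
(* Approximating u to within e/2/(|c| + 1) leaves at most e/2 for c u, also when c = 0. *)
have [phi tp pe] := au (e / 2 / (`|c| + 1)) (divr_gt0 e2 c1).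
have [psi tq qe] := av _ e2.
exists (c *: phi + psi); first exact: test_lin.
rewrite of_test_lin// opprD addrACA -scalerBr H1_normE.
have Hp : H1 D (u - of_test phi) by apply: lin_closedB => //; exact: H1_of_test.
have Hq : H1 D (v - of_test psi) by apply: lin_closedB => //; exact: H1_of_test.
move: (u - of_test phi) (v - of_test psi) pe qe Hp Hq => A B.
rewrite !H1_normE => pe qe HA HB.
have HcA : H1 D (c *: A) by exact: lin_closedZ.
have := form_normD l1 sf f0 HcA HB; rewrite (form_normZ _ l1 sf f0)// => h.
apply: le_lt_trans h _; rewrite [e]splitr; apply: ler_ltD => //.
apply: le_trans (_ : (`|c| + 1) * (e / 2 / (`|c| + 1)) <= _).
  apply: ler_pM => //; [exact: sqrtr_ge0|by rewrite lerDl|exact: ltW].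
by rewrite mulrC divfK// gt_eqF.
Qed.

Lemma H10_grad v : H10 D v -> grad_L2 D v.
Proof. by move=> [[]]. Qed.

End test_functions.

(** * Bump functions *)

Section bump.
Context {R : realType}.

(** The function t^-k exp(-1/t), extended by zero; the powers of 1/t make the family stable under
    differentiation up to linear combinations. *)
Definition flat (k : nat) (t : R) : R :=
  if 0 < t then t^-1 ^+ k * expR (- t^-1) else 0.

Lemma flat_ge0 k t : 0 <= flat k t.
Proof.
rewrite /flat; case: ifP => // t0.
by rewrite mulr_ge0 ?expR_ge0// exprn_ge0// invr_ge0 ltW.
Qed.

(** From exp(s) >= s^(k + 1)/(k + 1)! at s = 1/t. A bound linear in |t| gives continuity at 0. *)
Lemma flat_le k t : flat k t <= k.+1`!%:R * `|t|.
Proof.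
rewrite /flat; case: ifP => [t0|_]; last by rewrite mulr_ge0.
have s0 : 0 < t^-1 by rewrite invr_gt0.
rewrite expRN ler_pdivrMr ?expR_gt0// (gtr0_norm t0) mulrAC.
rewrite -ler_pdivrMr// -exprSr mulrC -ler_pdivrMr ?ltr0n ?fact_gt0//.
apply: le_trans (expR_ge1Dxn k (ltW s0)).
by rewrite lerDr.
Qed.

Lemma is_derive_flat (k : nat) (t : R) :
  is_derive t 1 (flat k) (- k%:R * flat k.+1 t + flat k.+2 t).
Proof.
have [t0|t0|->] := ltgtP t 0.
- have near0 : \near t, cst 0 t = flat k t.
    by near=> x; rewrite /flat ifF//; apply/negbTE; rewrite -leNgt ltW//; near: x;
      exact: lt_nbhsl.
  apply: (near_eq_is_derive near0); apply: is_derive_eq.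
  by rewrite /flat ifF ?(lt_gtF t0)// mulr0 addr0.
- have nearE : \near t, ((fun x : R => x^-1 ^+ k) * (fun x => expR (- x^-1))) t = flat k t.
    near=> x; rewrite /flat ifT//; near: x; exact: lt_nbhsr.
  apply: (near_eq_is_derive nearE).
  have tn0 : t != 0 by rewrite gt_eqF.
  have dV : is_derive t 1 (fun x : R => x^-1) (- t ^- 2).
    apply: is_derive_eq (is_deriveV (f := id) tn0 (is_derive_id t 1)) _.
    by rewrite /GRing.scale /= mulr1.
  have dX : is_derive t 1 (fun x : R => x^-1 ^+ k) (k%:R * t^-1 ^+ k.-1 * (- t ^- 2)).
    have -> : (fun x : R => x^-1 ^+ k) = (fun x : R => x^-1) ^+ k.
      by apply/funext => x; rewrite exprfctE.
    by apply: is_derive_eq (is_deriveX k dV) _.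
  have dN : is_derive t 1 (fun x : R => - x^-1) (t ^- 2).
    by apply: is_derive_eq (is_deriveN dV) _; rewrite opprK.
  have dE : is_derive t 1 (fun x : R => expR (- x^-1)) (expR (- t^-1) * t ^- 2).
    exact: (is_derive1_comp (is_derive_expR _) dN).
  apply: is_derive_eq (is_deriveM dX dE) _.
  rewrite /flat t0 /GRing.scale /=.
  case: k {nearE dX} => [|k] /=; first by field.
  by rewrite !exprS; field.
(* At 0 the difference quotient of [flat k] is [flat k.+1], which tends to 0. *)
- apply/is_derive1_caratheodory; exists (flat k.+1); split.
  + move=> z; rewrite /flat ltxx !subr0; case: ifP => z0; last by rewrite mul0r.
    by rewrite exprS; field; rewrite gt_eqF.
  + have f0 : flat k.+1 0 = 0 by rewrite /flat ltxx.
    apply/cvgrPdist_lt => e e0; rewrite f0.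
    set C : R := k.+2`!%:R; have C0 : 0 < C by rewrite ltr0n fact_gt0.
    near=> x; rewrite sub0r normrN ger0_norm ?flat_ge0//.
    apply: le_lt_trans (flat_le _ _) _; rewrite -/C mulrC -ltr_pdivlMr//.
    have : `|0 - x| < e / C by near: x; apply: cvgr_dist_lt => //; exact: divr_gt0.
    by rewrite sub0r normrN.
  + by rewrite /flat ltxx mulr0 addr0.
Unshelve. all: by end_near. Qed.

Context {m : nat}.

(* A class of functions closed under partial derivatives, hence made of smooth functions. *)
Inductive flat_alg : ('rV[R]_m -> R) -> Prop :=
| flat_alg_base k i (a c : R) : flat_alg (fun x => flat k (a * x 0 i + c))
| flat_alg_cst (c : R) : flat_alg (fun=> c)
| flat_algD f g : flat_alg f -> flat_alg g -> flat_alg (fun x => f x + g x)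
| flat_algM f g : flat_alg f -> flat_alg g -> flat_alg (fun x => f x * g x).

Lemma differentiable_affine_coord (i : 'I_m) (a c : R) (x : 'rV[R]_m) :
  differentiable (fun x : 'rV[R]_m => a * x 0 i + c) x.
Proof.
apply: (@differentiableD _ _ _ (fun x : 'rV[R]_m => a * x 0 i) (fun=> c)).
  apply: (@differentiableM _ _ (fun=> a) (fun x : 'rV[R]_m => x 0 i)).
    exact: differentiable_cst.
  exact: differentiable_coord.
exact: differentiable_cst.
Qed.

Lemma flat_alg_differentiable f x : flat_alg f -> differentiable f x.
Proof.
elim=> {f} [k i a c|c|f g _ df _ dg|f g _ df _ dg].
- apply: (@differentiable_comp _ _ _ _ (fun x : 'rV[R]_m => a * x 0 i + c) (flat k)).
    exact: differentiable_affine_coord.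
  by apply/derivable1_diffP; have [] := is_derive_flat k (a * x 0 i + c).
- exact: differentiable_cst.
- exact: differentiableD.
- exact: differentiableM.
Qed.

Lemma partial_flat_base k i (a c : R) j (x : 'rV[R]_m) :
  partial j (fun x => flat k (a * x 0 i + c)) x =
  (i == j)%:R * a * (- k%:R * flat k.+1 (a * x 0 i + c) + flat k.+2 (a * x 0 i + c)).
Proof.
set l : 'rV[R]_m -> R := fun x => a * x 0 i + c.
have dl : differentiable l x by exact: differentiable_affine_coord.
have [d1 d2] := is_derive_flat k (l x).
have df : differentiable (flat k) (l x) by exact/derivable1_diffP.
rewrite /partial deriveE; last first.
  exact: (@differentiable_comp _ _ _ _ l (flat k)).
rewrite (@diff_comp _ _ _ _ l (flat k))//=.
have dlE : 'D_(delta_mx 0 j) l x = (i == j)%:R * a.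
  apply: cvg_lim => //; apply: cvg_near_cst.
  near=> h; rewrite /= /l !mxE eqxx /= /GRing.scale /=.
  have h0 : h != 0 by near: h; exact: nbhs_dnbhs_neq.
  by field.
have -> : 'd l x (delta_mx 0 j) = (i == j)%:R * a by rewrite -dlE deriveE.
by rewrite deriv1E// derive1E d2 /GRing.scale.
Unshelve. all: by end_near. Qed.

Lemma flat_alg_partial f j : flat_alg f -> flat_alg (partial j f).
Proof.
elim=> {f} [k i a c|c|f g af IHf ag IHg|f g af IHf ag IHg].
- have -> : partial j (fun x : 'rV[R]_m => flat k (a * x 0 i + c)) =
      fun x => (i == j)%:R * a *
        (- k%:R * flat k.+1 (a * x 0 i + c) + flat k.+2 (a * x 0 i + c)).
    by apply/funext => x; exact: partial_flat_base.
  apply: flat_algM; first exact: flat_alg_cst.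
  apply: flat_algD; last exact: flat_alg_base.
  by apply: flat_algM; [exact: flat_alg_cst|exact: flat_alg_base].
- by rewrite (_ : partial j _ = fun=> 0); [exact: flat_alg_cst|exact: partial_cst].
- have -> : partial j (fun x => f x + g x) = fun x => partial j f x + partial j g x.
    by apply/funext => x; apply: deriveD; apply: diff_derivable;
      exact: flat_alg_differentiable.
  exact: flat_algD.
- have -> : partial j (fun x => f x * g x) =
      fun x => f x * partial j g x + g x * partial j f x.
    by apply/funext => x; apply: deriveM; apply: diff_derivable;
      exact: flat_alg_differentiable.
  by apply: flat_algD; apply: flat_algM.
Qed.

Lemma flat_alg_smooth f : flat_alg f -> smooth f.
Proof.
move=> af s x; apply: flat_alg_differentiable.
by elim: s => [//|i s IH] /=; exact: flat_alg_partial.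
Qed.

(** The i-th factor is nonzero exactly when |x_i - c_i| < h; the affine arguments have the shape
    that [flat_alg_base] expects. *)
Definition bump (c : 'rV[R]_m) (h : R) (x : 'rV[R]_m) : R :=
  \prod_i (flat 0 (1 * x 0 i + (h - c 0 i)) * flat 0 (-1 * x 0 i + (h + c 0 i))).

Lemma bump_smooth c h : smooth (bump c h).
Proof.
apply: flat_alg_smooth; rewrite /bump.
elim: (index_enum 'I_m) => [|i s IH].
  rewrite (_ : (fun x => _) = fun=> 1); first exact: flat_alg_cst.
  by apply/funext => x; rewrite big_nil.
rewrite (_ : (fun x => _) = fun x : 'rV[R]_m =>
  flat 0 (1 * x 0 i + (h - c 0 i)) * flat 0 (-1 * x 0 i + (h + c 0 i)) *
  \prod_(j <- s) (flat 0 (1 * x 0 j + (h - c 0 j)) * flat 0 (-1 * x 0 j + (h + c 0 j)))).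
  apply: flat_algM => //; apply: flat_algM; exact: flat_alg_base.
by apply/funext => x; rewrite big_cons.
Qed.

Lemma flat_gt0 k t : (0 < flat k t) = (0 < t).
Proof.
rewrite /flat; case: ifP => t0; last by rewrite ltxx.
by rewrite mulr_gt0 ?expR_gt0// exprn_gt0// invr_gt0.
Qed.

Lemma bump_neq0 c h x : bump c h x != 0 <-> cube c h x.
Proof.
have E i : (0 < flat 0 (1 * x 0 i + (h - c 0 i)) * flat 0 (-1 * x 0 i + (h + c 0 i))) =
    (`|x 0 i - c 0 i| < h).
  rewrite ltr_norml; apply/idP/andP => [|[h1 h2]].
    have f1 := flat_ge0 0 (1 * x 0 i + (h - c 0 i)).
    have f2 := flat_ge0 0 (-1 * x 0 i + (h + c 0 i)).
    rewrite lt_def mulf_eq0 negb_or => /andP[/andP[n1 n2] _].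
    have := flat_gt0 0 (1 * x 0 i + (h - c 0 i)); rewrite lt_def n1 f1 => /esym h1.
    have := flat_gt0 0 (-1 * x 0 i + (h + c 0 i)); rewrite lt_def n2 f2 => /esym h2.
    by move: h1 h2; rewrite -!/(is_true _) => h1 h2; split; lra.
  by rewrite mulr_gt0// flat_gt0; lra.
have ge i : 0 <= flat 0 (1 * x 0 i + (h - c 0 i)) * flat 0 (-1 * x 0 i + (h + c 0 i)).
  by rewrite mulr_ge0// flat_ge0.
split=> [/prodf_neq0 h0 i|hc].
  by rewrite -E lt_def h0// ge.
by apply/prodf_neq0 => i _; rewrite gt_eqF// E.
Qed.

(** The support lies in the closed cube of radius h, hence in the open cube of the larger radius
    h'. *)
Lemma bump_test (D : set 'rV[R]_m) c h h' : h < h' -> cube c h' `<=` D ->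
  test_function D (bump c h).
Proof.
move=> hh' cD.
pose K := [set v : 'rV[R]_m | forall i, `[(c 0 i - h), (c 0 i + h)]%classic (v ord0 i)].
have cK : compact K.
  apply: (@rV_compact R m (fun i => `[(c 0 i - h), (c 0 i + h)]%classic)) => i.
  exact: segment_compact.
have clK : closed K.
  rewrite (_ : K = \bigcap_(i in [set: 'I_m])
      ((fun v : 'rV[R]_m => v 0 i) @^-1` `[(c 0 i - h), (c 0 i + h)]%classic)).
    apply: closed_bigI => i _; apply: closed_comp; last exact: itv_closed.
    by move=> v _; exact: coord_continuous.
  by apply/seteqP; split=> [v vK i _|v vK i]; [exact: vK|exact: (vK i I)].
have sK : closure [set x | bump c h x != 0] `<=` K.
  rewrite [X in _ `<=` X]((closure_id K).1 clK); apply: closure_subset => x /bump_neq0 xc i /=.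
  by have := xc i; rewrite in_itv/= -ler_distl; exact: ltW.
split; first exact: bump_smooth.
- exact: (subclosed_compact (@closed_closure _ _) cK sK).
- move=> x /sK xK; apply: cD => i; have := xK i; rewrite /= in_itv/= -ler_distl.
  by move=> xi; exact: le_lt_trans hh'.
Qed.

End bump.

(** * Perturbation to a linearly independent family *)

Section independence.
Context {R : realType} {m : nat} (D : set 'rV[R]_m).
Local Notation mu := (@lebesgue_rV R m).
Context (m_gt0 : (0 < m)%N) (D_open : open D) (D_neq0 : D !=set0)
  (Dfin : (mu D < +oo)%E).

Let mD : measurable D := rV_open_measurable D_open.

Definition L2_form (f g : 'rV[R]_m -> R) := \int[mu]_(x in D) (f x * g x).

Lemma L2_form_sym : sym_form (Lp_on D 2%:E) L2_form.
Proof.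
split=> [u v _ _|c u v w lu lv lw].
  by apply: eq_Rintegral => x _; rewrite mulrC.
rewrite /L2_form -Rintegral_lin//; [|exact: Lp_on2M..].
by apply: eq_Rintegral => x _; rewrite !fctE mulrDl mulrA.
Qed.

Lemma Lp_on2_lin : lin_closed (@Lp_on R m D 2%:E).
Proof.
have l2 : (1 <= 2%:E :> \bar R)%E by exact: lee1n.
by split; [exact: Lp_on0|move=> c u v lu lv; exact: Lp_on_lin].
Qed.

Lemma L2_form_ae0 f g : Lp_on D 2%:E f -> Lp_on D 2%:E g ->
  f = 0 %[ae mu in D] -> L2_form f g = 0.
Proof.
move=> lf lg f0.
have -> : 0 = \int[mu]_(x in D) (0 : R) by rewrite Rintegral_cst// mul0r.
congr fine; apply: ae_eq_integral => //.
- by have [] := integrableP _ _ _ (Lp_on2M mD lf lg).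
- by apply: filterS f0 => x h Dx; rewrite h// mul0r.
Qed.

(** A continuous function that is nonzero somewhere is nonzero on an open set, which has positive
    measure; a zero integral of phi^2 would make that set null. *)
Lemma test_L2_gt0 phi : test_function D phi -> phi != 0 -> 0 < L2_form phi phi.
Proof.
move=> tp phi0; have lp := test_Lp mD Dfin tp.
have h0 : 0 <= L2_form phi phi.
  by apply: Rintegral_ge0 => x _; rewrite -expr2 sqr_ge0.
rewrite lt_def h0 andbT; apply: contra_neqN phi0 => /eqP I0.
have ip := Lp_on2M mD lp lp.
have [mp _] := integrableP _ _ _ ip.
have E0 : (\int[mu]_(x in D) `|(phi x * phi x)%:E| = 0)%E.
  transitivity (\int[mu]_(x in D) (phi x * phi x)%:E)%E.
    by apply: eq_integral => x _; rewrite gee0_abs// lee_fin -expr2 sqr_ge0.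
  by rewrite -[LHS]fineK; [congr EFin; exact: I0|exact: integrable_fin_num].
have [N [mN N0 sN]] := (ae_eq_integral_abs mu mD mp).1 E0.
apply: contrapT => phi_neq0.
have oS : open (phi @^-1` [set x | x != 0]).
  apply: open_comp; last exact: open_neq.
  by move=> x _; exact: (@test_continuous _ _ _ _ tp).
have S0 : phi @^-1` [set x | x != 0] !=set0.
  apply: contrapT => h; apply: phi_neq0; apply/funext => x; apply/eqP.
  by apply: contra_notT h => px; exists x.
have := lebesgue_open_gt0 oS S0; rewrite ltNge => /negP; apply.
rewrite -N0; apply: le_measure; rewrite ?inE//; first exact: rV_open_measurable.
move=> x px; apply: sN => /= h; have px0 : phi x <> 0 by apply/eqP.
have Dx : D x by apply: contrapT => nD; apply: px0; exact: test_out nD.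
by have [] := h Dx => /eqP; rewrite mulf_eq0 orbb => /eqP.
Qed.

Lemma disjoint_bumps n : exists psi : 'I_n -> 'rV[R]_m -> R,
  [/\ forall j, test_function D (psi j), forall j, psi j != 0 &
      forall i j, i != j -> forall x, psi i x * psi j x = 0].
Proof.
have [x0 Dx0] := D_neq0; have [h h0 hD] := open_cube D_open Dx0.
pose N : R := n.+1%:R; have N0 : 0 < N by rewrite ltr0n.
(* Centres 2r apart along the first axis keep the cubes of radius r disjoint, and even the cubes of
   radius 2r stay within 2r(n + 1) = h/2 of x0. *)
pose r : R := h / (4 * N).
have r0 : 0 < r by rewrite divr_gt0// mulr_gt0.
have hE : h = 4 * N * r by rewrite /r; field; rewrite gt_eqF.
pose i0 : 'I_m := Ordinal m_gt0.
pose c (j : 'I_n) : 'rV[R]_m := x0 + (2 * r * j.+1%:R) *: delta_mx 0 i0.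
have cE j i : c j 0 i = x0 0 i + 2 * r * j.+1%:R * (i == i0)%:R.
  by rewrite !mxE eqxx.
have tb j : test_function D (bump (c j) r).
  apply: (@bump_test _ _ _ _ _ (2 * r)); first by lra.
  move=> x xc; apply: hD => i; have := xc i; rewrite cE => xi.
  have jn : j.+1%:R <= N - 1.
    by rewrite /N lerBrDr natr1 ler_nat ltnS ltn_ord.
  have j0 : 0 <= j.+1%:R :> R by [].
  have b1 : 2 * r * j.+1%:R <= 2 * r * (N - 1) by rewrite ler_wpM2l// mulr_ge0 ?(ltW r0).
  have b0 : 0 <= 2 * r * j.+1%:R.
    by apply: mulr_ge0 => //; apply: mulr_ge0 => //; exact: ltW.
  have Nr : 0 < N * r by exact: mulr_gt0.
  move: xi; rewrite !ltr_norml hE; case: (i == i0); rewrite ?mulr1 ?mulr0 => /andP[? ?];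
    apply/andP; split; lra.
have nz j : bump (c j) r != 0.
  apply/eqP => b0; have : bump (c j) r (c j) != 0.
    by apply/bump_neq0 => i; rewrite subrr normr0.
  by rewrite b0 eqxx.
exists (fun j => bump (c j) r); split=> // i j ij x.
apply/eqP; rewrite mulf_eq0; apply/negPn/negP.
rewrite negb_or => /andP[/bump_neq0/(_ i0) xi /bump_neq0/(_ i0)].
move: xi; rewrite !cE eqxx !mulr1 !ltr_norml => /andP[a1 a2] /andP[a3 a4].
have r2 : 0 < 2 * r by rewrite mulr_gt0.
have /orP[lt|lt] : (i < j)%N || (j < i)%N by rewrite -neq_ltn.
  have : i.+2%:R <= j.+1%:R :> R by rewrite ler_nat.
  by move/(ler_wpM2l (ltW r2)); rewrite -natr1; lra.
have : j.+2%:R <= i.+1%:R :> R by rewrite ler_nat.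
by move/(ler_wpM2l (ltW r2)); rewrite -natr1; lra.
Qed.

Lemma orthonormal_tests n : exists phi : 'I_n -> 'rV[R]_m -> R,
  (forall j, test_function D (phi j)) /\
  (forall i j, L2_form (phi i) (phi j) = (i == j)%:R).
Proof.
have [psi [tp nz pp]] := disjoint_bumps n.
have [s [s0 sE]] : exists s : 'I_n -> R,
    (forall j, 0 < s j) /\ (forall j, s j ^+ 2 = L2_form (psi j) (psi j)).
  exists (fun j => Num.sqrt (L2_form (psi j) (psi j))).
  by split=> j; rewrite ?sqrtr_gt0 ?sqr_sqrtr ?ltW//; exact: test_L2_gt0.
have lpb j : Lp_on D 2%:E (psi j) := test_Lp mD Dfin (tp j).
exists (fun j => (s j)^-1 *: psi j); split=> [j|i j].
  by rewrite -[_ *: _]addr0; apply: test_lin => //; exact: test0.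
rewrite (formZl _ Lp_on2_lin L2_form_sym)//; last exact: (lin_closedZ _ Lp_on2_lin).
rewrite (formZr _ Lp_on2_lin L2_form_sym)//.
have [->|ij] := eqVneq i j.
  by rewrite -sE /= ?eqxx; field; rewrite gt_eqF.
have -> : L2_form (psi i) (psi j) = \int[mu]_(x in D) (0 : R).
  by apply: eq_Rintegral => x _; exact: pp.
by rewrite Rintegral_cst// mul0r !mulr0.
Qed.

(** The independence clause of [subspace_of_dim]: it looks at the function component, up to null
    sets. *)
Definition ae_free n (w : 'I_n -> @sobolev R m) : Prop :=
  forall c : 'I_n -> R, (\sum_i c i *: w i).1 = 0 %[ae mu in D] -> forall i, c i = 0.

Lemma sobolev_sum_fst n (c : 'I_n -> R) (w : 'I_n -> @sobolev R m) :
  (\sum_i c i *: w i).1 = \sum_i c i *: (w i).1.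
Proof. by elim/big_rec2: _ => // i x y _ <-. Qed.

(* The pairings of t i + e phi i with phi j form the matrix L + e I, which is singular
   only when - e is an eigenvalue of L. *)
Lemma ae_free_perturb n : exists2 phi : 'I_n -> 'rV[R]_m -> R,
  forall j, test_function D (phi j) &
  forall t : 'I_n -> @sobolev R m, (forall i, H10 D (t i)) ->
  forall e0, 0 < e0 -> exists2 e, 0 < e <= e0 &
    ae_free (fun i => t i + e *: of_test (phi i)).
Proof.
have [phi [tp pp]] := orthonormal_tests n; exists phi => // t Ht e0 e00.
pose L : 'M[R]_n := \matrix_(i, j) L2_form (t i).1 (phi j).
have lphi j : Lp_on D 2%:E (phi j) := test_Lp mD Dfin (tp j).
have lt i : Lp_on D 2%:E (t i).1 by have [[]] := Ht i.
(* Of the n + 1 distinct numbers -e0/(k + 1), at most n are roots of the characteristic polynomial,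
   which has degree n. *)
have [k kn kL] : exists2 k : nat, (k < n.+1)%N & ~~ root (char_poly L) (- (e0 / k.+1%:R)).
  apply: contrapT => h.
  have all_root : all (root (char_poly L)) [seq - (e0 / k.+1%:R) | k <- iota 0 n.+1].
    apply/allP => _ /mapP[k + ->]; rewrite mem_iota add0n => /andP[_ kn].
    by apply: contra_notT h => kr; exists k.
  have un : uniq [seq - (e0 / k.+1%:R) : R | k <- iota 0 n.+1].
    rewrite map_inj_uniq ?iota_uniq// => k l /oppr_inj /(mulfI (lt0r_neq0 e00)).
    by move/invr_inj/eqP; rewrite eqr_nat => /eqP[].
  have := max_poly_roots (monic_neq0 (char_poly_monic L)) all_root un.
  by rewrite size_char_poly size_map size_iota ltnn.
have k0 : (0 : R) < k.+1%:R by rewrite ltr0n.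
set e := e0 / k.+1%:R in kL *; exists e.
  rewrite divr_gt0//= ler_pdivrMr// ler_peMr ?(ltW e00)//.
  by rewrite -[1]/(1%:R) ler_nat.
move=> c cw i.
pose v : 'rV[R]_n := \row_i c i.
(* Pairing the combination that vanishes almost everywhere with each phi_j. *)
have key : v *m L = (- e) *: v.
  apply/rowP => j; rewrite !mxE.
  have lw i' : Lp_on D 2%:E (t i' + e *: of_test (phi i')).1.
    by have [_ h] := Lp_on2_lin; rewrite /= addrC; exact: h.
  have lsum : Lp_on D 2%:E (\sum_i c i *: (t i + e *: of_test (phi i)).1).
    exact: (lin_closed_sum _ _ _ Lp_on2_lin).
  have := L2_form_ae0 lsum (lphi j); rewrite -sobolev_sum_fst => /(_ cw).
  rewrite sobolev_sum_fst (form_suml _ _ _ Lp_on2_lin L2_form_sym)//.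
  under eq_bigr => i' _.
    rewrite /= (formDl Lp_on2_lin L2_form_sym)//; last exact: (lin_closedZ _ Lp_on2_lin).
    rewrite (formZl _ Lp_on2_lin L2_form_sym)// pp mulrDr.
    over.
  rewrite big_split/= [X in _ + X](bigD1 j)//= eqxx mulr1 [X in _ + (_ + X)]big1 ?addr0; last first.
    by move=> i' /negbTE ->; rewrite !mulr0.
  move/eqP; rewrite addr_eq0 => /eqP h; rewrite mulNr [e * _]mulrC -h.
  by apply: eq_bigr => i' _; rewrite !mxE.
apply/eqP; apply: contraNT kL => ci; rewrite -eigenvalue_root_char.
apply/eigenvalueP; exists v => //; apply/eqP => v0.
by move: ci; have := congr1 (fun M : 'rV[R]_n => M 0 i) v0; rewrite !mxE => ->; rewrite eqxx.
Qed.

End independence.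

(** * The width estimate *)

Lemma num_monomials_gt p n : (n < num_monomials p.+1 n.+1)%N.
Proof.
rewrite /num_monomials; elim: n => [|n IH]; first by rewrite bin_gt0 addn0.
have : (0 < 'C(p.+1 + n, p))%N by rewrite bin_gt0; lia.
by rewrite addnS binS; lia.
Qed.

(** With at least one variable the count is unbounded in K; K is one below the least order whose
    count exceeds n. That order is positive, as the count at order 0 is 0. *)
Lemma num_monomials_bracket p n : exists K,
  (num_monomials p.+1 K <= n < num_monomials p.+1 K.+1)%N.
Proof.
have ex : exists K, (n < num_monomials p.+1 K)%N.
  by exists n.+1; exact: num_monomials_gt.
case: (ex_minnP ex) => -[//|K] hK min; exists K; rewrite hK andbT leqNgt.
by apply/negP => /min; rewrite ltnn.
Qed.

Section exponential_bound.
Context {R : realType}.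

(** For rho > 0, n < (K + 1)^p gives n^(1/p) <= K + 1, hence rho^(K + 1) <= exp(-|ln rho| n^(1/p));
    the factor rho^-1 turns K + 1 into K. *)
Lemma power_le_exp (rho : R) (p n K : nat) : 0 <= rho < 1 -> (0 < p)%N ->
  (n < K.+1 ^ p)%N ->
  rho ^+ K <= (if rho == 0 then 1 else rho^-1) *
              expR (- (`|ln rho| * n%:R `^ (p%:R)^-1)).
Proof.
move=> /andP[rho0 rho1] p0 nK.
have [->|rhon0] := eqVneq rho 0.
  (* ln 0 = 0, so that the exponential is 1. *)
  rewrite ln0// normr0 mul0r oppr0 expR0 mulr1.
  by case: K {nK} => [|K]; rewrite ?expr0// expr0n.
have rhop : 0 < rho by rewrite lt_def rhon0.
have x_le : n%:R `^ (p%:R)^-1 <= K.+1%:R :> R.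
  have -> : K.+1%:R = ((K.+1 ^ p)%:R : R) `^ (p%:R)^-1.
    rewrite natrX -powR_mulrn// -powRrM divff ?powRr1// pnatr_eq0; lia.
  rewrite ge0_ler_powR ?invr_ge0 ?nnegrE//.
  by rewrite ler_nat ltnW.
have ln_lt : ln rho < 0 by rewrite ln_lt0// rhop.
rewrite ler0_norm ?(ltW ln_lt)// mulNr opprK.
rewrite -[leLHS](mulKf rhon0) -exprS ler_wpM2l ?invr_ge0//.
rewrite -{1}(lnK rhop) -expRM_natr ler_expR.
by rewrite ler_wnM2l// ltW.
Qed.

End exponential_bound.

(** * The energy norm and the contraction constant *)

Section energy.
Context {R : realType} {m : nat} (D : set 'rV[R]_m).
Local Notation mu := (@lebesgue_rV R m).
Context (mD : measurable D) (muD0 : (0 < mu D)%E) (Dfin : (mu D < +oo)%E).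

Let mu0 : (0 < mu setT)%E.
Proof. by apply: lt_le_trans muD0 _; apply: le_measure; rewrite ?inE. Qed.

(** A set of positive measure is not contained in a null set. This turns almost-everywhere bounds
    into inequalities between constants. *)
Lemma ae_witness (P : set 'rV[R]_m) : {ae mu, forall x, D x -> P x} ->
  exists2 x, D x & P x.
Proof.
move=> [N [mN N0 sN]]; apply: contrapT => h.
have DN : D `<=` N.
  by move=> x Dx; apply: sN => /(_ Dx) Px; apply: h; exists x.
have : (mu D <= mu N)%E by apply: le_measure; rewrite ?inE.
by rewrite N0 leNgt muD0.
Qed.

Lemma diffusion_H10_sym a : Lp_on D +oo%E a -> sym_form (H10 D) (diffusion D a).
Proof.
move=> la; have [s1 s2] := diffusion_sym_form mD mu0 la.
split=> [u v Hu Hv|c u v w Hu Hv Hw].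
  by apply: s1; exact: H10_grad.
by apply: s2; exact: H10_grad.
Qed.

(** Stated for [c *: a + 0], the shape to which [diffusion_coef_lin] and [Lp_on_lin] apply. *)
Lemma diffusion_coef_scale c a v : Lp_on D +oo%E a -> H10 D v ->
  diffusion D (c *: a + 0) v v = c * diffusion D a v v.
Proof.
move=> la /H10_grad lv; rewrite diffusion_coef_lin//; last by apply: Lp_on0; exact: leey.
rewrite [X in _ + X](_ : _ = 0) ?addr0// /diffusion.
under eq_Rintegral do rewrite mul0r.
by rewrite Rintegral_cst// mul0r.
Qed.

Context (abar : 'rV[R]_m -> R) (r : R) (labar : Lp_on D +oo%E abar) (r0 : 0 < r)
  (rabar : {ae mu, forall x, D x -> r <= abar x}).
Local Notation L := (Linf_norm D abar).

Lemma Linf_ge : r <= L.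
Proof.
have [x _ /andP[h1 h2]] : exists2 x, D x & (r <= abar x) && (`|abar x| <= L).
  apply: ae_witness; apply: filterS2 rabar (Linf_ae mu0 labar) => x h1 h2 Dx.
  by rewrite h1// h2.
by rewrite (le_trans h1)// (le_trans _ h2)// ler_norm.
Qed.

Lemma diffusion_energy_ge v : H10 D v ->
  r * V_norm D v ^+ 2 <= diffusion D abar v v.
Proof.
move=> Hv; have lv := H10_grad Hv; have l1 := Lp_on_cst1 mD.
have -> : V_norm D v ^+ 2 = diffusion D (cst 1) v v.
  rewrite V_normE sqr_sqrtr//; apply: Rintegral_ge0 => x _.
  by rewrite mul1r dot_ge0.
rewrite -diffusion_coef_scale//; apply: diffusion_le => //.
  by apply: Lp_on_lin => //; [exact: leey|apply: Lp_on0; exact: leey].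
by apply: filterS rabar => x h Dx; rewrite !fctE /GRing.scale /= mulr1 addr0 h.
Qed.

Lemma diffusion_energy_le v : H10 D v ->
  diffusion D abar v v <= L * V_norm D v ^+ 2.
Proof.
move=> Hv; have lv := H10_grad Hv; have l1 := Lp_on_cst1 mD.
have -> : V_norm D v ^+ 2 = diffusion D (cst 1) v v.
  rewrite V_normE sqr_sqrtr//; apply: Rintegral_ge0 => x _.
  by rewrite mul1r dot_ge0.
rewrite -diffusion_coef_scale//; apply: diffusion_le => //.
  by apply: Lp_on_lin => //; [exact: leey|apply: Lp_on0; exact: leey].
apply: filterS (Linf_ae mu0 labar) => x h Dx.
rewrite !fctE /GRing.scale /= mulr1 addr0.
by rewrite (le_trans (ler_norm _))// h.
Qed.

Lemma diffusion_energy_ge0 v : H10 D v -> 0 <= diffusion D abar v v.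
Proof.
move=> Hv; apply: le_trans (diffusion_energy_ge Hv).
by rewrite mulr_ge0 ?sqr_ge0// ltW.
Qed.

Lemma V_norm_le_energy v : H10 D v ->
  V_norm D v <= form_norm (diffusion D abar) v / Num.sqrt r.
Proof.
move=> Hv; rewrite ler_pdivlMr ?sqrtr_gt0// -(ger0_norm (sqrtr_ge0 _ : 0 <= V_norm D v)).
rewrite -sqrtr_sqr -sqrtrM ?sqr_ge0// ler_sqrt ?diffusion_energy_ge0//.
by rewrite mulrC diffusion_energy_ge.
Qed.

Lemma energy_le_V_norm v : H10 D v ->
  form_norm (diffusion D abar) v <= Num.sqrt L * V_norm D v.
Proof.
move=> Hv; have L0 : 0 <= L by rewrite (le_trans (ltW r0))// Linf_ge.
rewrite -(ger0_norm (sqrtr_ge0 _ : 0 <= V_norm D v)) -sqrtr_sqr -sqrtrM//.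
have LV0 : 0 <= L * V_norm D v ^+ 2 by rewrite mulr_ge0 ?sqr_ge0.
rewrite ler_sqrt//. exact: diffusion_energy_le.
Qed.

Context (d : nat) (psi : 'I_d -> 'rV[R]_m -> R) (lpsi : forall i, Lp_on D +oo%E (psi i)).
Context (elliptic : forall y : 'I_d -> R, (forall i, `|y i| <= 1) ->
  {ae mu, forall x, D x -> r <= abar x - \sum_i y i * psi i x}).

(** Ellipticity at z gives sum_i z_i psi_i <= abar - r, and abar <= L gives (r/L) abar <= r, so the
    sum is at most (1 - r/L) abar. Taking z = y and z = -y gives both signs. *)
Lemma diffusion_psi_bound y v : (forall i, `|y i| <= 1) -> H10 D v ->
  `|\sum_i y i * diffusion D (psi i) v v| <= (1 - r / L) * diffusion D abar v v.
Proof.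
move=> hy Hv; have lv := H10_grad Hv; have Lp := lt_le_trans r0 Linf_ge.
suff H z : (forall i, `|z i| <= 1) ->
    \sum_i z i * diffusion D (psi i) v v <= (1 - r / L) * diffusion D abar v v.
  rewrite ler_norml H// andbT lerNl -sumrN.
  have := H (fun i => - y i); rewrite (eq_bigr _ (fun i _ => mulNr _ _)).
  by apply=> i; rewrite normrN.
move=> hz; rewrite -diffusion_coef_sum// -diffusion_coef_scale//.
have py : (1 <= +oo :> \bar R)%E by exact: leey.
apply: diffusion_le => //.
- exact: Lp_on_sum.
- by apply: Lp_on_lin => //; apply: Lp_on0; exact: leey.
apply: filterS2 (elliptic hz) (Linf_ae mu0 labar) => x h1 h2 Dx.
rewrite fct_sumE !fctE /GRing.scale /= addr0 mulrBl mul1r.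
have := h1 Dx; have : r / L * abar x <= r.
  rewrite mulrAC ler_pdivrMr// ler_wpM2l ?(ltW r0)//.
  by rewrite (le_trans (ler_norm _))// h2.
by lra.
Qed.

End energy.

Unset Implicit Arguments.

Theorem mainTheorem4 (R : realType) (m : nat) (D : set 'rV[R]_m)
    (m_gt0 : (0 < m)%N)
    (D_open : open D) (D_connected : connected D) (D_neq0 : D !=set0)
    (D_bounded : bounded_set D)
    (g : @sobolev R m) (rho : R) (g_V : H10 D g) :
  exists C : R,
  forall (d : nat) (abar : 'rV[R]_m -> R) (psi : 'I_d -> 'rV[R]_m -> R)
    (r Rmax theta : R) (f : @sobolev R m -> R) (u : 'rV[R]_d -> @sobolev R m),
  let U := [set y : 'rV[R]_d | forall i, -1 <= y 0 i <= 1] in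
  (2 <= d)%N ->
  Lp_on D +oo%E abar ->
  (forall i, Lp_on D +oo%E (psi i)) ->
  0 < r -> r <= Rmax ->
  (forall y, U y -> {ae lebesgue_rV m, forall x, D x ->
     r <= abar x - \sum_i y 0 i * psi i x <= Rmax}) ->
  V_dual D f ->
  (forall y, U y -> H10 D (u y) /\ forall v, H10 D v ->
     diffusion D abar (u y) v - \sum_i y 0 i * diffusion D (psi i) (u y) v
       = f v) ->
  0 < theta < 1 ->
  (forall w v, H10 D w -> H10 D v ->
     \sum_i diffusion D (psi i) w v = theta * diffusion D abar w v) ->
  (forall v, H10 D v -> diffusion D abar g v = f v) ->
  rho = 1 - r / Linf_norm D abar ->
  forall n : nat,
  (kolmogorov_width D n (u @` U) <=
   (C * expR (- (`|ln rho| * n%:R `^ (d.-1%:R)^-1)))%:E)%E.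
Proof.
(* The factors are the bound on the solution, the norm conversion sqrt(L/r) = 1/sqrt(1 - rho), and
   the shift from K to K + 1, which is 1 when rho = 0. Only g and rho may appear, the other data
   being quantified afterwards. *)
exists (V_norm D g / (1 - rho) / Num.sqrt (1 - rho) * (if rho == 0 then 1 else rho^-1)).
move=> d abar psi r Rmax theta f u U d2 labar lpsi r0 rR ell _ uE _ thetaE gE rhoE n.
have mD := rV_open_measurable D_open.
have Dfin := lebesgue_bounded_fin mD D_bounded.
have muD0 := lebesgue_open_gt0 D_open D_neq0.
case: d => [|[|p]]// in psi u U d2 lpsi ell uE thetaE *.
have Urow (y : 'I_p.+2 -> R) : (forall i, `|y i| <= 1) -> U (\row_i y i).
  by move=> hy i; rewrite mxE -ler_norml.
have elliptic (y : 'I_p.+2 -> R) : (forall i, `|y i| <= 1) ->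
    {ae lebesgue_rV m, forall x, D x -> r <= abar x - \sum_i y i * psi i x}.
  move=> /Urow /ell; apply: filterS => x h Dx; have /andP[+ _] := h Dx.
  by under eq_bigr do rewrite mxE.
(* Ellipticity at y = 0. *)
have rabar : {ae lebesgue_rV m, forall x, D x -> r <= abar x}.
  have := elliptic (fun=> 0); rewrite normr0 => /(_ (fun=> ler01)).
  apply: filterS => x h Dx; have := h Dx.
  by rewrite big1 ?subr0// => i _; rewrite mul0r.
have rL := Linf_ge mD muD0 labar rabar; set L := Linf_norm D abar in rL rhoE.
have L0 : 0 < L by exact: lt_le_trans rL.
have rho0 : 0 <= rho by rewrite rhoE subr_ge0 ler_pdivrMr// mul1r.
have rho1 : rho < 1 by rewrite rhoE gtrBl divr_gt0.
have lH := @H10_lin R m D mD Dfin.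
have sa := diffusion_H10_sym mD muD0 labar.
have sb i := diffusion_H10_sym mD muD0 (lpsi i).
have a0 := diffusion_energy_ge0 mD muD0 labar r0 rabar.
have ba := diffusion_psi_bound mD muD0 labar r0 rabar lpsi elliptic.
rewrite -/L -rhoE in ba.
have [K /andP[Kn nK]] := num_monomials_bracket p n.
(* Test functions are added with a factor e <= eta/(S + 1), where S is the sum of their energy
   norms, so each error is at most eta. *)
have free (t : 'I_n -> @sobolev R m) (eta : R) : (forall i, H10 D (t i)) -> 0 < eta ->
    exists w, [/\ forall i, H10 D (w i), @ae_free R m D n w &
                  forall i, form_norm (diffusion D abar) (t i - w i) <= eta].
  move=> Ht eta0.
  have [phi tphi hphi] := ae_free_perturb m_gt0 D_open D_neq0 Dfin n.
  have Hphi i : H10 D (of_test (phi i)) by exact: H10_of_test.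
  pose S := \sum_i form_norm (diffusion D abar) (of_test (phi i)).
  have S0 : 0 <= S by apply: sumr_ge0 => i _; exact: sqrtr_ge0.
  have S1 : 0 < S + 1 by rewrite ltr_wpDl.
  have [e /andP[e0 eS] fr] := hphi t Ht _ (divr_gt0 eta0 S1).
  exists (fun i => t i + e *: of_test (phi i)); split; [move=> i|exact: fr|move=> i].
    by apply: (lin_closedD lH); [exact: Ht|exact: (lin_closedZ _ lH (Hphi i))].
  have -> : t i - (t i + e *: of_test (phi i)) = (- e) *: of_test (phi i).
    by rewrite opprD addrA subrr add0r scaleNr.
  rewrite (form_normZ _ lH sa a0 (Hphi i)) normrN (gtr0_norm e0).
  apply: le_trans (_ : eta / (S + 1) * S <= _).
    apply: ler_pM => //; [exact: ltW|exact: sqrtr_ge0|].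
    by rewrite /S (bigD1 i)//= lerDl; apply: sumr_ge0 => j _; exact: sqrtr_ge0.
  by rewrite mulrAC ler_pdivrMr// ler_wpM2l ?(ltW eta0)// lerDl.
(* An arbitrary e is added to the bound. The Galerkin error is taken to be e sqrt(r), because
   returning from the energy norm to the V-norm divides by sqrt(r). *)
apply/lee_addgt0Pr => e e0.
have sr0 : 0 < Num.sqrt r by rewrite sqrtr_gt0.
have solve (y : 'I_p.+2 -> R) : (forall i, `|y i| <= 1) ->
    solves (H10 D) (diffusion D abar) (fun i => diffusion D (psi i)) g y
      (u (\row_i y i)).
  move=> /Urow/uE[Hu uf]; split=> // v Hv; rewrite gE// -uf//.
  by congr (_ - _); apply: eq_bigr => i _; rewrite mxE.
have [w [Hw fw approx]] := @galerkin_independent R _ (H10 D) (diffusion D abar) p.+1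
  (fun i => diffusion D (psi i)) rho theta g lH sa sb a0 rho0 rho1 g_V
  (fun y hy v Hv => ba y v hy Hv) thetaE
  (@ae_free R m D) (fun y => u (\row_i y i)) K n (e * Num.sqrt r) free Kn
  (mulr_gt0 e0 sr0) solve.
apply: ge_ereal_inf; eexists.
  by exists (range (fun c : 'I_n -> R => \sum_i c i *: w i)) => //; exists w.
apply: ge_ereal_sup => _ [_ [y Uy <-] <-].
have hy i : `|y 0 i| <= 1 by rewrite ler_norml; exact: Uy.
have [c hc] := approx _ hy.
rewrite (_ : \row_i y 0 i = y) in hc; last by apply/rowP => i; rewrite mxE.
apply: ge_ereal_inf; eexists.
  by exists (\sum_i c i *: w i) => //; exists c.
rewrite -EFinD lee_fin.
have Huw : H10 D (u y - \sum_i c i *: w i).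
  by apply: (lin_closedB lH); [have [] := uE _ Uy|exact: (lin_closed_sum _ _ _ lH)].
apply: le_trans (V_norm_le_energy mD muD0 labar r0 rabar Huw) _.
rewrite ler_pdivrMr//; apply: le_trans hc _; rewrite mulrDl lerD2r.
have r1 : 0 < 1 - rho by rewrite subr_gt0.
have := energy_le_V_norm mD muD0 labar r0 rabar g_V; rewrite -/L => gL.
(* As 1 - rho = r/L, this eliminates r and L from the final bound. *)
have sL : Num.sqrt L = Num.sqrt r / Num.sqrt (1 - rho).
  have -> : 1 - rho = r / L by rewrite rhoE opprB addrC subrK.
  by rewrite sqrtrM ?(ltW r0)// sqrtrV ?(ltW L0)// invfM invrK mulrA divff ?mul1r// gt_eqF.
have rp : 0 <= rho < 1 by rewrite rho0.
have nKp : (n < K.+1 ^ p.+1)%N by exact: leq_trans nK (num_monomials_le _ _).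
have E := power_le_exp rp (ltn0Sn p) nKp; rewrite -[p.+1]/(p.+2.-1) in E.
set X := expR _ in E *; set Y := (if _ then _ else _) in E *.
apply: le_trans (_ : Y * X * (Num.sqrt L * V_norm D g / (1 - rho)) <= _).
  apply: ler_pM => //; first exact: exprn_ge0.
    by rewrite divr_ge0 ?sqrtr_ge0// ltW.
  by rewrite ler_wpM2r// invr_ge0 ltW.
rewrite sL le_eqVlt; apply/orP; left; apply/eqP; field.
by rewrite !gt_eqF// sqrtr_gt0.
Qed.
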